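(* Let $k\ge3$, and let $G,H\in\mathrm{PGL}_k(\mathbb{C})$ be hyperbolic transformations which are simultaneously conjugate into $\mathrm{PGL}_k(\mathbb{R})$, with eigendirection flag pairs $A,C$ (of $G$) and $B,D$ (of $H$) such that $A,B,C,D$ are in generic position. Let $M\in\mathrm{PGL}_k(\mathbb{C})$ be an elliptic or mixed type transformation with at most one hyperbolic eigendirection, with eigendirection flag pair $\beta,\beta'$ such that $A,\beta,C,D$ are in generic position and $A,\beta',C,D$ are in generic position. All of $G,H,M$ are assumed to have generic eigenvalues. Then $M$ is simultaneously conjugate into $\mathrm{PGL}_k(\mathbb{R})$ together with $G$ and $H$ if and only if: (a) $[A,\beta,C,D]=\overline{[A,\beta',C,D]}$ for each of the $k-1$ projections; (b) $r_3(A,\beta,C)=\overline{r_3(A,\beta',C)}$ for each of the $\frac{(k-1)(k-2)}{2}$ projections.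
   Context: $\mathrm{PGL}_k(\mathbb{R})$ is regarded as the image of $\mathrm{GL}_k(\mathbb{R})$ in $\mathrm{PGL}_k(\mathbb{C})$. Transformations $M_j$ are simultaneously conjugate into $\mathrm{PGL}_k(\mathbb{R})$ if a single $\Gamma\in\mathrm{PGL}_k(\mathbb{C})$ satisfies $\Gamma^{-1}M_j\Gamma\in\mathrm{PGL}_k(\mathbb{R})$ for all $j$. Types. The eigenvalues of (a representative of) $M$ are $\mathrm{PGL}_k(\mathbb{R})$-compatible if there is a real line $\ell$ through $0$ in $\mathbb{C}$ such that every eigenvalue lies in $\ell$ or is swapped with another eigenvalue by reflection about $\ell$. Eigenvalues in $\ell$ (and their eigendirections) are hyperbolic; those swapped in pairs are elliptic, and their eigendirections form elliptic eigendirection pairs. $M$ is hyperbolic if all eigenvalues are hyperbolic, elliptic if all are elliptic, mixed if compatible but neither. Generic eigenvalues: no repeated eigenvalues, no two eigenvalues both contained in a line through $0$ and swapped by reflection about a line through $0$, and the labelling and pairing do not depend on the choice of $\ell$. Flags. A flag $F$ in $\mathbb{C}^k$ is $0\subsetneq F_1\subsetneq\dots\subsetneq F_k=\mathbb{C}^k$ with $\dim F_j=j$. For a transformation with ordered eigendirections $m_1,\dots,m_k$, the eigendirection flag pair is $\beta_j=\langle m_1,\dots,m_j\rangle$, $\beta'_j=\langle m_k,\dots,m_{k-j+1}\rangle$. For elliptic or mixed $M$ with at most one hyperbolic eigendirection the ordering is such that $m_j$ and $m_{k+1-j}$ form an elliptic eigendirection pair for each $j\neq k+1-j$ (the hyperbolic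 eigendirection, if any, being in the middle). Flags $A,B,\dots,Z$ are in generic position if $A_{i_A}\oplus\cdots\oplus Z_{i_Z}=\mathbb{C}^k$ whenever $i_A,\dots,i_Z\ge 0$ and $i_A+\dots+i_Z=k$. Cross ratios. In $\mathbb{C}P^1=\mathbb{C}\cup\{\infty\}$, $[a,b,c,d]=\frac{(a-d)(c-b)}{(a-b)(c-d)}$. For flags $A,B,C,D$ in generic position, the $k-1$ projections of $[A,B,C,D]$ are, for $i+j=k-2$, $i,j\ge0$, the cross ratios $[A^{i,j},B^{i,j},C^{i,j},D^{i,j}]$ of the four lines in the two-dimensional space $\mathbb{C}^k/(A_i\oplus C_j)$ given by the images of $A_{i+1}\oplus C_j$, $B_1\oplus A_i\oplus C_j$, $A_i\oplus C_{j+1}$, $D_1\oplus A_i\oplus C_j$ respectively. Triple ratios. For three flags in generic position in a 3-dimensional space with $v_a,v_b,v_c$ spanning $A_1,B_1,C_1$ and linear forms $f_a,f_b,f_c$ with kernels $A_2,B_2,C_2$, $r_3(A,B,C)=\frac{f_a(v_b)f_b(v_c)f_c(v_a)}{f_a(v_c)f_b(v_a)f_c(v_b)}$. For flags $A,\beta,C$ in generic position in $\mathbb{C}^k$, the projections of $r_3(A,\beta,C)$ are, for $i+j+l=k-3$, $i,j,l\ge 0$, the triple ratios of the three flags in the 3-dimensional space $\mathbb{C}^k/(A_i\oplus C_j\oplus\beta_l)$ given by the images of $A_{i+1}\subset A_{i+2}$, $\beta_{l+1}\subset\beta_{l+2}$, $C_{j+1}\subset C_{j+2}$ (each summed with $A_i\oplus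 C_j\oplus\beta_l$). Equalities in the claim compare the projections with the same indices. *)

(* Defs.v *)
From mathcomp Require Export all_boot all_order all_algebra.
From mathcomp Require Export complex.
From mathcomp Require Export classical_sets reals.

Set Implicit Arguments.
Unset Strict Implicit.
Unset Printing Implicit Defensive.

Import Order.TTheory GRing.Theory Num.Theory.
Local Open Scope ring_scope.
Local Open Scope complex_scope.

(* Elements of PGL_k(C) are given by representatives in GL_k(C), i.e. by
   M : 'M[R[i]]_k with M \in unitmx, acting on column vectors; every notion
   below is invariant under M |-> c *: M for c != 0. *)

Section RealForms.
Variables (R : realType) (k : nat).
Implicit Types (M Gam : 'M[R[i]]_k).

Definition in_PGLR M : Prop :=
  exists c : R[i], c != 0 /\
  exists N : 'M[R]_k, N \in unitmx /\ M = c *: map_mx (real_complex R) N.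

Definition conjugate_into_PGLR (Ms : seq 'M[R[i]]_k) : Prop :=
  exists Gam, Gam \in unitmx /\
  forall M, M \in Ms -> in_PGLR (invmx Gam *m M *m Gam).

End RealForms.

Section Types.
Variable R : realType.
Implicit Types (u v a b : R[i]).

(* A real line through 0 is given by a direction u != 0. *)
Definition in_line u a : Prop := exists t : R, a = t%:C * u.

(* u / u^* = (u / |u|)^2, so this is the reflection about the line R u. *)
Definition reflection u a : R[i] := u / u^* * a^*.

Variable k : nat.
Implicit Type M : 'M[R[i]]_k.

Definition compatible_line M u : Prop :=
  u != 0 /\
  forall a, eigenvalue M a ->
    in_line u a \/
    exists b, [/\ eigenvalue M b, b != a & reflection u a = b].

Definition PGLR_compatible M : Prop := exists u, compatible_line M u.

Definition hyperbolic M : Prop :=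
  exists u, compatible_line M u /\
  forall a, eigenvalue M a -> in_line u a.

Definition elliptic M : Prop :=
  exists u, compatible_line M u /\
  forall a, eigenvalue M a -> ~ in_line u a.

Definition mixed M : Prop :=
  [/\ PGLR_compatible M, ~ hyperbolic M & ~ elliptic M].

(* Counts eigenvalues; when none is repeated these correspond to
   eigendirections. *)
Definition at_most_one_hyperbolic M : Prop :=
  exists u, compatible_line M u /\
  forall a b, eigenvalue M a -> eigenvalue M b ->
    in_line u a -> in_line u b -> a = b.

Definition elliptic_pair M a b : Prop :=
  exists u, [/\ compatible_line M u, eigenvalue M a, eigenvalue M b,
                ~ in_line u a & reflection u a = b].

Definition generic_eigenvalues M : Prop :=
  [/\ forall a, eigenvalue M a -> mup a (char_poly M) = 1%N,
      forall a b, eigenvalue M a -> eigenvalue M b -> a != b ->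
        ~ ((exists u, [/\ u != 0, in_line u a & in_line u b]) /\
           (exists v, v != 0 /\ reflection v a = b))
    & forall u v, compatible_line M u -> compatible_line M v ->
        forall a b, eigenvalue M a -> eigenvalue M b ->
          (in_line u a <-> in_line v a) /\
          (reflection u a = b <-> reflection v a = b)].

End Types.

Section Flags.
Variable F : fieldType.

(* The values of a flag at indices j > k are irrelevant. *)
Record flag (k : nat) := Flag {
  flag_space :> nat -> {vspace 'cV[F]_k};
  flag_dim : forall j, (j <= k)%N -> \dim (flag_space j) = j;
  flag_sub : forall j, (j < k)%N -> (flag_space j <= flag_space j.+1)%VS }.

Definition generic_position (k n : nat) (Fs : n.-tuple (flag k)) : Prop :=
  forall i : 'I_n -> nat, (\sum_(t < n) i t)%N = k ->
    directv (\sum_(t < n) tnth Fs t (i t))%VS /\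
    (\sum_(t < n) tnth Fs t (i t))%VS = fullv.

(* lam lists the eigenvalues of M in the order of the eigendirections. *)
Definition ordered_eigendirections (k : nat) (M : 'M[F]_k)
    (lam : 'I_k -> F) (m : 'I_k -> 'cV[F]_k) : Prop :=
  basis_of fullv [tuple m j | j < k] /\
  forall j, M *m m j = lam j *: m j.

Definition flags_of_directions (k : nat) (m : 'I_k -> 'cV[F]_k)
    (b b' : flag k) : Prop :=
  forall j, (j <= k)%N ->
    b j = (\sum_(s < k | (s < j)%N) <[m s]>)%VS /\
    b' j = (\sum_(s < k | (s < j)%N) <[m (rev_ord s)]>)%VS.

Definition eigenflag_pair (k : nat) (M : 'M[F]_k) (b b' : flag k) : Prop :=
  exists lam m, ordered_eigendirections M lam m /\ flags_of_directions m b b'.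

End Flags.

Definition paired_eigenflag_pair (R : realType) (k : nat) (M : 'M[R[i]]_k)
    (b b' : flag R[i] k) : Prop :=
  exists lam m,
    [/\ ordered_eigendirections M lam m,
        forall j, rev_ord j != j -> elliptic_pair M (lam j) (lam (rev_ord j))
      & flags_of_directions m b b'].

Section Ratios.
Variable F : fieldType.

Definition det2 (x y : 'cV[F]_2) : F :=
  x ord0 0 * y ord_max 0 - y ord0 0 * x ord_max 0.

(* The line spanned by (x0, x1) is the point x0 / x1 of the projective line
   F + {oo}. For x and y in homogeneous coordinates
   det2 x y = x1 y1 (x0 / x1 - y0 / y1), and the factors x1 y1 cancel in
   (a - d) (c - b) / ((a - b) (c - d)). *)
Definition cross_ratio (a b c d : {vspace 'cV[F]_2}) : F :=
  det2 (vpick a) (vpick d) * det2 (vpick c) (vpick b) /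
  (det2 (vpick a) (vpick b) * det2 (vpick c) (vpick d)).

Definition form_of_kernel (n : nat) (U : {vspace 'cV[F]_n}) :
    'Hom('cV[F]_n, F^o) :=
  xget 0 [set f | lker f = U]%classic.

(* A, B, C are flags in a 3-dimensional space, of which only the line (index 1)
   and the plane (index 2) are used. *)
Definition triple_ratio (A B C : nat -> {vspace 'cV[F]_3}) : F :=
  let va := vpick (A 1%N) in let vb := vpick (B 1%N) in let vc := vpick (C 1%N) in
  let fa := form_of_kernel (A 2%N) in
  let fb := form_of_kernel (B 2%N) in
  let fc := form_of_kernel (C 2%N) in
  (fa vb * fb vc * fc va) / (fa vc * fb va * fc vb).

Variable k : nat.

(* The quotient of F^k by a subspace W of codimension d, identified with F^d by
   choosing a linear surjection onto F^d with kernel W. Two choices differ by an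
   automorphism of F^d, which changes neither ratio. *)
Definition quotient_map (d : nat) (W : {vspace 'cV[F]_k}) :
    'Hom('cV[F]_k, 'cV[F]_d) :=
  xget 0 [set f | lker f = W /\ limg f = fullv]%classic.

Definition cross_ratio_proj (A B C D : flag F k) (i j : nat) : F :=
  let W := (A i + C j)%VS in
  let q := quotient_map 2 W in
  cross_ratio (q @: (A i.+1 + C j)) (q @: (B 1%N + W))
              (q @: (A i + C j.+1)) (q @: (D 1%N + W)).

Definition triple_ratio_proj (A B C : flag F k) (i j l : nat) : F :=
  let W := (A i + C j + B l)%VS in
  let q := quotient_map 3 W in
  triple_ratio (fun s => (q @: (A (i + s)%N + W))%VS)
               (fun s => (q @: (B (l + s)%N + W))%VS)
               (fun s => (q @: (C (j + s)%N + W))%VS).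

End Ratios.

(* Main.v *)
Require Import Defs.
From HB Require Import structures.
From mathcomp Require Import ring zify ssrAC.

(* Let sigma be the antilinear involution of C^k whose fixed points are Gam R^k,
   where Gam conjugates G and H into PGL_k(R). A transformation lies in the
   corresponding real form iff it commutes with sigma up to a scalar; then sigma
   permutes its eigendirections by the reflection of the eigenvalues about the
   line. Hence sigma fixes the flags of the hyperbolic G and H, and M is real for
   Gam iff sigma exchanges its paired eigendirections, i.e. iff sigma sends beta'
   to beta. Since sigma conjugates cross ratios and triple ratios, (a) and (b) say
   that beta and sigma beta' have the same ratios with respect to A, C, D.

   These ratios determine beta. Let psi_i be a linear form with kernel
   beta_l + A_i + C_(k-1-l-i). Given beta_l, the ratios fix psi_i(b) / psi_(i+1)(b)
   for all i, where b spans beta_(l+1) modulo beta_l, and the kernels of the psi_i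
   intersect in beta_l; so b is fixed up to a scalar modulo beta_l. *)

Set Implicit Arguments.
Unset Strict Implicit.
Unset Printing Implicit Defensive.

Import GRing.Theory.
Local Open Scope ring_scope.
Local Open Scope complex_scope.

(** * Linear forms and their kernels *)

Section LinearForms.
Variables (F : fieldType) (vT : vectType F).
Implicit Types (U W : {vspace vT}) (f g : 'Hom(vT, F^o)).

(** Send a basis of [W] to zeros and a basis of a complement to a basis of [rT]; rank-nullity then
    turns the inclusion of [W] in the kernel into an equality. *)
Lemma exists_surjection_with_kernel (rT : vectType F) W :
  (\dim W + \dim (fullv : {vspace rT}))%N = \dim (fullv : {vspace vT}) ->
  exists f : 'Hom(vT, rT), lker f = W /\ limg f = fullv.
Proof.
move=> dimW.
have dxW : directv (W + W^C).
  by rewrite directv_addE !directv_trivial /=; apply/eqP; exact: capv_compl.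
have := cat_basis dxW (vbasisP W) (vbasisP (W^C)%VS).
rewrite addv_complf => /andP[/eqP spX freeX].
have szC : \dim (W^C) = \dim (fullv : {vspace rT}).
  apply/eqP; rewrite -(eqn_add2l (\dim W)) dimW; apply/eqP.
  by have := directvP dxW; rewrite /= addv_complf => <-.
set Y : seq rT := nseq (\dim W) 0 ++ vbasis fullv.
have [h hP] := linear_of_free (vbasis W ++ vbasis W^C) Y.
have {hP} hXY : [seq h i | i <- vbasis W ++ vbasis W^C] = Y.
  by apply: hP; rewrite // !size_cat size_nseq !size_tuple szC.
have /eqP := hXY; rewrite map_cat eqseq_cat; last first.
  by rewrite size_map size_nseq size_tuple.
case/andP=> /eqP hW /eqP hC.
exists (linfun h).
have imf : limg (linfun h) = fullv.
  rewrite -spX limg_span -(span_basis (vbasisP (fullv : {vspace rT}))).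
  rewrite map_cat (eq_map (lfunE h)) hW (eq_map (lfunE h)) hC span_cat.
  apply/eqP; rewrite eqEsubv; apply/andP; split; last exact: addvSr.
  rewrite subv_add subvv andbT; apply/span_subvP => x /nseqP [-> _]; exact: mem0v.
split=> //; apply/esym/eqP; rewrite eqEdim; apply/andP; split.
  rewrite -{1}(span_basis (vbasisP W)); apply/span_subvP => x xW.
  rewrite memv_ker lfunE.
  have : h x \in [seq h i | i <- vbasis W] by apply: map_f.
  by rewrite hW => /nseqP [-> _].
have := limg_ker_dim (linfun h) fullv.
by rewrite capfv imf -dimW => /addIn ->.
Qed.

(* Restatements over F rather than F^o, on which the ring lemmas do not match. *)
Lemma formD f u v : f (u + v) = f u + f v :> F. Proof. by rewrite raddfD. Qed.
Lemma formB f u v : f (u - v) = f u - f v :> F. Proof. by rewrite raddfB. Qed.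
Lemma formZ f a v : f (a *: v) = a * f v :> F. Proof. by rewrite linearZZ. Qed.
Lemma memv_ker_form f v : (v \in lker f) = (f v == 0 :> F).
Proof. exact: memv_ker. Qed.

Lemma exists_form_with_kernel U :
  (\dim U).+1 = \dim (fullv : {vspace vT}) ->
  exists f, lker f = U.
Proof.
move=> dimU; have [|f [kf _]] := @exists_surjection_with_kernel F^o U.
  by rewrite [X in (_ + X)%N]dimvf /dim /= addn1.
by exists f.
Qed.

(** The difference of the two sides is the value of [g] at [f u *: w - f w *: u], a vector of
    [lker f]. *)
Lemma ker_form_cross f g u w :
  (lker f <= lker g)%VS -> f u * g w = f w * g u.
Proof.
move=> /subvP sfg.
have : f u *: w - f w *: u \in lker g.
  by apply: sfg; rewrite memv_ker_form formB !formZ mulrC subrr.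
by rewrite memv_ker_form formB !formZ subr_eq0 => /eqP.
Qed.

Lemma sub_ker_form f g v :
  (lker f <= lker g)%VS -> g v != 0 :> F ->
  exists2 c, c != 0 & forall w, g w = c * f w :> F.
Proof.
move=> sfg gv.
have fv : f v != 0 :> F.
  by apply: contraNneq gv => fv; rewrite -memv_ker_form (subvP sfg) // memv_ker_form fv.
exists (g v / f v) => [|w]; first by rewrite mulf_neq0 ?invr_eq0.
apply: (mulfI fv); rewrite (ker_form_cross v w sfg).
by rewrite mulrA [f v * _]mulrC mulfVK // mulrC.
Qed.

Lemma eq_ker_form f g :
  lker f = lker g -> exists2 c, c != 0 & forall w, g w = c * f w :> F.
Proof.
move=> kfg; have [kg|] := eqVneq (lker g) fullv.
  exists 1; rewrite ?oner_neq0 // => w.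
  by apply/eqP; rewrite mul1r (eqP (_ : f w == 0 :> F)) -memv_ker_form ?kfg kg memvf.
rewrite eqEsubv subvf => /subvPn[v _]; rewrite memv_ker_form => gv.
by apply: (@sub_ker_form f g v) gv; rewrite kfg.
Qed.

End LinearForms.

(** * Both ratios as values of linear forms on the whole space *)

Section RatioFormulas.
Variables (F : fieldType) (k : nat).
Local Notation V := 'cV[F]_k.
Implicit Types (U W : {vspace V}) (x y : 'cV[F]_2).

Lemma dim_cV n : \dim (fullv : {vspace 'cV[F]_n}) = n.
Proof. by rewrite dimvf /dim /= muln1. Qed.

Lemma quotient_mapP d W : (\dim W + d)%N = k ->
  lker (quotient_map d W) = W /\ limg (quotient_map d W) = fullv.
Proof.
move=> dimW; rewrite /quotient_map.
have [|f kf] := @exists_surjection_with_kernel F V 'cV[F]_d W.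
  by rewrite !dim_cV.
by case: xgetP => [g _ //|/(_ f) []].
Qed.

Lemma form_of_kernelP n (U : {vspace 'cV[F]_n}) :
  (\dim U).+1 = n -> lker (form_of_kernel U) = U.
Proof.
move=> dimU; rewrite /form_of_kernel.
have [|f kf] := @exists_form_with_kernel F _ U; first by rewrite dim_cV.
by case: xgetP => [g _ //|/(_ f) []].
Qed.

(** [vpick] returns some nonzero vector of the image line; knowing it up to a scalar is enough,
    since each vector occurs equally often above and below in a ratio. *)
Lemma vpick_limg_line (rT : vectType F) (q : 'Hom(V, rT)) W v :
  lker q = W -> v \notin W ->
  exists2 c, c != 0 & vpick (q @: (<[v]> + W)) = c *: q v.
Proof.
move=> kq vW; have imq : (q @: (<[v]> + W) = <[q v]>)%VS.
  by rewrite limgD limg_line -kq (eqP (_ : q @: lker q == 0)%VS) ?addv0 // -lkerE.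
have := memv_pick (q @: (<[v]> + W)); rewrite imq => /vlineP[c cE].
exists c => //; apply: contraNneq vW => c0.
move/eqP: cE; rewrite c0 scale0r vpick0 -subv0 -memvE memv0.
by rewrite -kq memv_ker.
Qed.

Lemma det2Zl a x y : det2 (a *: x) y = a * det2 x y.
Proof. by rewrite /det2 !mxE; ring. Qed.

Lemma det2Zr a x y : det2 x (a *: y) = a * det2 x y.
Proof. by rewrite /det2 !mxE; ring. Qed.

Lemma det2_linear x : linear (det2 x : 'cV[F]_2 -> F^o).
Proof. by move=> a y z; rewrite /det2 !mxE /GRing.scale /=; ring. Qed.

Lemma det2xx x : det2 x x = 0.
Proof. by rewrite /det2; ring. Qed.

Lemma det2_nondegenerate x : x != 0 -> exists y, det2 x y != 0.
Proof.
move=> x0; have [x00|x00] := eqVneq (x ord0 0) 0.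
  exists (delta_mx ord0 0); rewrite /det2 x00 !mxE /= mul0r sub0r oppr_eq0 mul1r.
  apply: contra_neq x0 => x01; apply/colP => i; rewrite mxE.
  case: i => [[|[|//]] i]; first by rewrite -[RHS]x00; congr (x _ _); apply/val_inj.
  by rewrite -[RHS]x01; congr (x _ _); apply/val_inj.
by exists (delta_mx ord_max 0); rewrite /det2 !mxE /= mul0r subr0 mulr1.
Qed.

(** Pairing with [q v] by [det2] kills [v] and [W], and is not zero because [q v] is nonzero and [q]
    is onto; so it is proportional to [f]. *)
Lemma det2_pullback (q : 'Hom(V, 'cV[F]_2)) W v (f : 'Hom(V, F^o)) :
  lker q = W -> limg q = fullv -> v \notin W -> lker f = (<[v]> + W)%VS ->
  exists2 c, c != 0 & forall w, det2 (q v) (q w) = c * f w.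
Proof.
move=> kq imq vW kf.
pose Dl := GRing.isLinear.Build F 'cV[F]_2 F^o _ (det2 (q v)) (@det2_linear (q v)).
pose D : {linear 'cV[F]_2 -> F^o} := HB.pack (det2 (q v) : _ -> F^o) Dl.
have gE w : (linfun D \o q)%VF w = det2 (q v) (q w) by rewrite comp_lfunE lfunE.
have [|y y0] := @det2_nondegenerate (q v); first by rewrite -memv_ker kq.
have : y \in limg q by rewrite imq memvf.
case/memv_imgP=> u _ yE.
have [||c c0 cE] := @sub_ker_form _ _ f (linfun D \o q)%VF u.
- rewrite kf subv_add -memvE memv_ker gE det2xx eqxx /=.
  apply/subvP => w; rewrite -kq memv_ker memv_ker gE => /eqP->.
  by rewrite /det2 !mxE mulr0 mul0r subr0.
- by rewrite gE -yE.
by exists c => // w; rewrite -gE cE.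
Qed.

(** The scalars [a], [b], [c], [d] of the vectors and [s], [t] of the forms each occur once above
    and once below, so the choices made by [vpick] and [quotient_map] cancel. *)
Lemma cross_ratio_quotient W (FA FC : 'Hom(V, F^o)) va vb vc vd :
  (\dim W + 2)%N = k ->
  [/\ va \notin W, vb \notin W, vc \notin W & vd \notin W] ->
  lker FA = (<[va]> + W)%VS -> lker FC = (<[vc]> + W)%VS ->
  let q := quotient_map 2 W in
  cross_ratio (q @: (<[va]> + W)) (q @: (<[vb]> + W))
              (q @: (<[vc]> + W)) (q @: (<[vd]> + W))
  = FA vd * FC vb / (FA vb * FC vd).
Proof.
move=> dimW [aW bW cW dW] kA kC q; have [kq imq] := quotient_mapP dimW.
rewrite -/q in kq imq; rewrite /cross_ratio.
have [a a0 ->] := vpick_limg_line kq aW.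
have [b b0 ->] := vpick_limg_line kq bW.
have [c c0 ->] := vpick_limg_line kq cW.
have [d d0 ->] := vpick_limg_line kq dW.
have [s s0 sE] := det2_pullback kq imq aW kA.
have [t t0 tE] := det2_pullback kq imq cW kC.
rewrite !det2Zl !det2Zr !sE !tE.
have e0 : a * b * c * d * s * t != 0 by rewrite !mulf_neq0.
rewrite -[RHS]mul1r -(divff e0) mulf_div; congr (_ / _); ring.
Qed.

(** As [U] contains [lker q], the form on the quotient pulled back along [q] has kernel exactly
    [U]. *)
Lemma form_of_kernel_pullback n (q : 'Hom(V, 'cV[F]_n)) U (f : 'Hom(V, F^o)) :
  (lker q <= U)%VS -> (\dim U).+1 = (\dim (lker q) + n)%N -> lker f = U ->
  exists2 c, c != 0 & forall w, form_of_kernel (q @: U)%VS (q w) = c * f w.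
Proof.
move=> sqU dimU kf.
have dimq : (\dim (q @: U)%VS).+1 = n.
  apply/eqP; rewrite -(eqn_add2l (\dim (lker q))) -dimU addnS eqSS.
  by rewrite -(limg_ker_dim q U) (capv_idPr sqU).
have [|c c0 cE] := @eq_ker_form _ _ f (form_of_kernel (q @: U) \o q)%VF.
  apply/vspaceP => w; rewrite kf memv_ker comp_lfunE -memv_ker form_of_kernelP //.
  apply/idP/idP => [|/memv_imgP[u uU e]]; first exact: memv_img.
  rewrite -[w](subrK u) rpredD // (subvP sqU) // memv_ker linearB /= e subrr //.
by exists c => // w; rewrite -cE comp_lfunE.
Qed.

Lemma triple_ratio_quotient W (Fa Fb Fc : 'Hom(V, F^o)) va vb vc
    (A B C : nat -> {vspace 'cV[F]_3}) :
  (\dim W + 3)%N = k ->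
  [/\ va \notin W, vb \notin W & vc \notin W] ->
  [/\ (W <= lker Fa)%VS, (W <= lker Fb)%VS & (W <= lker Fc)%VS] ->
  [/\ (\dim (lker Fa)).+1 = k, (\dim (lker Fb)).+1 = k & (\dim (lker Fc)).+1 = k] ->
  let q := quotient_map 3 W in
  A 1%N = (q @: (<[va]> + W))%VS -> A 2%N = (q @: lker Fa)%VS ->
  B 1%N = (q @: (<[vb]> + W))%VS -> B 2%N = (q @: lker Fb)%VS ->
  C 1%N = (q @: (<[vc]> + W))%VS -> C 2%N = (q @: lker Fc)%VS ->
  triple_ratio A B C = (Fa vb * Fb vc * Fc va) / (Fa vc * Fb va * Fc vb).
Proof.
move=> dimW [aW bW cW] [sa sb sc] [da db dc] q A1 A2 B1 B2 C1 C2.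
have [kq imq] := quotient_mapP dimW; rewrite -/q in kq imq.
rewrite /triple_ratio A1 A2 B1 B2 C1 C2.
have [a a0 ->] := vpick_limg_line kq aW.
have [b b0 ->] := vpick_limg_line kq bW.
have [c c0 ->] := vpick_limg_line kq cW.
rewrite -kq in sa sb sc dimW.
have [r r0 rE] := form_of_kernel_pullback sa (etrans da (esym dimW)) erefl.
have [s s0 sE] := form_of_kernel_pullback sb (etrans db (esym dimW)) erefl.
have [t t0 tE] := form_of_kernel_pullback sc (etrans dc (esym dimW)) erefl.
rewrite !formZ !rE !sE !tE.
have e0 : a * b * c * r * s * t != 0 by rewrite !mulf_neq0.
rewrite -[RHS]mul1r -(divff e0) mulf_div; congr (_ / _); ring.
Qed.

End RatioFormulas.

(** * Transverse triples of flags and their ratio projections *)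

Section Flags.
Variables (F : fieldType) (k : nat).
Local Notation V := 'cV[F]_k.
Implicit Types (U W : {vspace V}) (A B C D : flag F k).

Lemma flag0 A : A 0%N = 0%VS.
Proof. by apply/eqP; rewrite -dimv_eq0 flag_dim. Qed.

Lemma flag_mono A i j : (i <= j)%N -> (j <= k)%N -> (A i <= A j)%VS.
Proof.
elim: j => [|j IHj]; first by rewrite leqn0 => /eqP->; rewrite subvv.
rewrite leq_eqVlt => /predU1P[-> _|ij jk]; first exact: subvv.
exact: subv_trans (IHj ij (ltnW jk)) (flag_sub _ jk).
Qed.

Lemma flag_vector A j : (j < k)%N -> exists2 v, v \in A j.+1 & v \notin A j.
Proof.
move=> jk; apply/subvPn; apply/negP => /dimvS.
by rewrite !flag_dim ?ltnn // ltnW.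
Qed.

Lemma flag_step A j v : (j < k)%N -> v \in A j.+1 -> v \notin A j ->
  A j.+1 = (<[v]> + A j)%VS.
Proof.
move=> jk vA vnA; apply/esym/eqP; rewrite eqEdim; apply/andP; split.
  by rewrite subv_add -memvE vA flag_sub.
rewrite flag_dim // -[j in (j < _)%N](flag_dim A (ltnW jk)).
rewrite ltn_neqAle dimvS ?addvSr // andbT; apply/eqP => e.
move/negP: vnA; apply; rewrite memvE.
have /eqP-> : A j == (<[v]> + A j)%VS by rewrite eqEdim addvSr e /=.
exact: addvSl.
Qed.

Lemma flag1 A v : (0 < k)%N -> v \in A 1%N -> v != 0 -> A 1%N = <[v]>%VS.
Proof.
by move=> k0 vA v0; rewrite (@flag_step A 0 v) // flag0 ?addv0 // memv0.
Qed.

(** The dimensions add up to [k], so a sum that spans is also direct. [A] and [C] come first as the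
    frame against which the third flag is measured. *)
Definition transverse A C B :=
  forall i j l, (i + j + l)%N = k -> (A i + C j + B l)%VS = fullv.

(** Subadditivity gives the upper bound. For the lower one, enlarge [B l] to the [B l'] that
    completes the indices to [k]: the total is then full, while the sum still meets [B l'] in at
    least [B l]. *)
Lemma transverse_dim A C B i j l : transverse A C B -> (i + j + l <= k)%N ->
  \dim (A i + C j + B l) = (i + j + l)%N.
Proof.
move=> tr le_k; apply/eqP; rewrite eqn_leq; apply/andP; split.
  apply: leq_trans (leq_of_leqif (dimv_add_leqif _ _)) _; rewrite leq_add ?flag_dim //; last by lia.
  by apply: leq_trans (leq_of_leqif (dimv_add_leqif _ _)) _; rewrite !flag_dim //; lia.
set l' := (k - (i + j))%N.
have /esym := dimv_sum_cap (A i + C j + B l) (B l').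
have -> : (A i + C j + B l + B l' = fullv)%VS.
  have sB : (B l <= B l')%VS by apply: flag_mono; rewrite /l'; lia.
  by rewrite -addvA (addv_idPr sB) tr // /l'; lia.
rewrite dim_cV (@flag_dim _ _ B l'); last by rewrite /l'; lia.
have : (l <= \dim ((A i + C j + B l) :&: B l'))%N.
  rewrite -{1}(@flag_dim _ _ B l); last lia.
  by apply: dimvS; rewrite subv_cap addvSr flag_mono // /l'; lia.
rewrite /l'; lia.
Qed.

Lemma notin_dim W v n : \dim W = n -> \dim (<[v]> + W) = n.+1 -> v \notin W.
Proof.
move=> dW dvW; apply/negP; rewrite memvE => /addv_idPr vW.
by move: dvW; rewrite vW dW => /eqP; rewrite eqn_leq ltnn andbF.
Qed.

(** Modulo [A i + C j] the hyperplanes [lker FA] and [lker FC] are the lines coming from [A i.+1]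
    and [C j.+1], so any forms with these kernels compute the ratio. *)
Lemma cross_ratio_projE A B C D i j (FA FC : 'Hom(V, F^o)) vb vd :
  (i + j + 2)%N = k -> transverse A C B -> transverse A C D ->
  lker FA = (A i.+1 + C j)%VS -> lker FC = (A i + C j.+1)%VS ->
  vb \in B 1%N -> vb != 0 -> vd \in D 1%N -> vd != 0 ->
  cross_ratio_proj A B C D i j = FA vd * FC vb / (FA vb * FC vd).
Proof.
move=> ijk trB trD kA kC vbB vb0 vdD vd0; rewrite /cross_ratio_proj.
have k0 : (0 < k)%N by lia.
have [ik jk] : (i < k)%N /\ (j < k)%N by lia.
have [va vaA vaW] := flag_vector A ik; have [vc vcC vcW] := flag_vector C jk.
have dimE i' j' : (i' + j' <= k)%N -> \dim (A i' + C j') = (i' + j')%N.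
  by move=> ?; have := @transverse_dim A C B i' j' 0 trB; rewrite flag0 addv0 addn0 => ->.
have dW : \dim (A i + C j) = (i + j)%N by apply: dimE; lia.
have EA : (A i.+1 + C j = <[va]> + (A i + C j))%VS.
  by rewrite (flag_step ik vaA vaW) addvA.
have EC : (A i + C j.+1 = <[vc]> + (A i + C j))%VS.
  by rewrite (flag_step jk vcC vcW) !addvA (addvC (A i)).
rewrite EA EC (flag1 k0 vbB vb0) (flag1 k0 vdD vd0).
apply: cross_ratio_quotient => //; rewrite -?EA -?EC ?kA ?kC //; first by rewrite dW.
split; apply: (notin_dim dW).
- by rewrite -EA dimE; lia.
- by rewrite -(flag1 k0 vbB vb0) addvC transverse_dim //; lia.
- by rewrite -EC dimE; lia.
- by rewrite -(flag1 k0 vdD vd0) addvC transverse_dim //; lia.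
Qed.

Lemma triple_ratio_projE A B C i j l (Fa Fb Fc : 'Hom(V, F^o)) va vb vc :
  (i + j + l + 3)%N = k -> transverse A C B ->
  lker Fa = (A i.+2 + C j + B l)%VS -> lker Fb = (A i + C j + B l.+2)%VS ->
  lker Fc = (A i + C j.+2 + B l)%VS ->
  va \in A i.+1 -> va \notin A i -> vb \in B l.+1 -> vb \notin B l ->
  vc \in C j.+1 -> vc \notin C j ->
  triple_ratio_proj A B C i j l
  = (Fa vb * Fb vc * Fc va) / (Fa vc * Fb va * Fc vb).
Proof.
move=> ijlk tr ka kb kc vaA vaW vbB vbW vcC vcW; rewrite /triple_ratio_proj.
have [ik jk lk] : [/\ (i < k)%N, (j < k)%N & (l < k)%N] by split; lia.
have dimE i' j' l' : (i' + j' + l' <= k)%N -> \dim (A i' + C j' + B l') = (i' + j' + l')%N.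
  by apply: transverse_dim.
set W := (A i + C j + B l)%VS.
have dW : \dim W = (i + j + l)%N by apply: dimE; lia.
have EA : (A i.+1 + C j + B l = <[va]> + W)%VS.
  by rewrite (flag_step ik vaA vaW) /W !addvA.
have EC : (A i + C j.+1 + B l = <[vc]> + W)%VS.
  by rewrite (flag_step jk vcC vcW) /W !addvA (addvC (A i)).
have EB : (A i + C j + B l.+1 = <[vb]> + W)%VS.
  by rewrite (flag_step lk vbB vbW) addvA [(_ + <[vb]>)%VS]addvC -addvA.
have A2 : (A i.+2 + W = lker Fa)%VS.
  by rewrite ka /W !addvA (addv_idPl (_ : A i <= A i.+2)%VS) // flag_mono //; lia.
have B2 : (B l.+2 + W = lker Fb)%VS.
  by rewrite kb /W addvC -addvA (addv_idPr (_ : B l <= B l.+2)%VS) // flag_mono //; lia.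
have C2 : (C j.+2 + W = lker Fc)%VS.
  have sC : (C j <= C j.+2)%VS by rewrite flag_mono //; lia.
  by rewrite kc /W !addvA [(_ + A i)%VS]addvC -(addvA (A i)) (addv_idPl sC).
have A1 : (A i.+1 + W = <[va]> + W)%VS.
  by rewrite (flag_step ik vaA vaW) -addvA (addv_idPr (_ : A i <= W)%VS) // /W -addvA addvSl.
have B1 : (B l.+1 + W = <[vb]> + W)%VS.
  by rewrite (flag_step lk vbB vbW) -addvA (addv_idPr (_ : B l <= W)%VS) // /W addvSr.
have C1 : (C j.+1 + W = <[vc]> + W)%VS.
  rewrite (flag_step jk vcC vcW) -addvA (addv_idPr (_ : C j <= W)%VS) // /W.
  by rewrite (addvC (A i)) -addvA addvSl.
apply: (triple_ratio_quotient (Fa := Fa) (Fb := Fb) (Fc := Fc));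
  rewrite ?addn1 ?addn2 ?A1 ?B1 ?C1 ?A2 ?B2 ?C2 //.
- by rewrite dW.
- split; apply: (notin_dim dW); rewrite -?EA -?EB -?EC dimE; lia.
- by split; rewrite -?A2 -?B2 -?C2 addvSr.
- by split; rewrite ?ka ?kb ?kc dimE; lia.
Qed.

End Flags.

(** * Determination of a flag by its ratios *)

Section Uniqueness.
Variables (F : fieldType) (k : nat).
Local Notation V := 'cV[F]_k.
Implicit Types (A B C D : flag F k).

Section Notin.
Variables (A C B : flag F k) (i j l : nat).
Hypotheses (tr : transverse A C B) (ijl : (i + j + l < k)%N).

Lemma transverse_notinl v : v \in A i.+1 -> v \notin A i -> v \notin (A i + C j + B l)%VS.
Proof.
move=> vA vA'; apply: (notin_dim (transverse_dim tr (ltnW ijl))).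
by rewrite !addvA -(flag_step _ vA vA') ?transverse_dim //; lia.
Qed.

Lemma transverse_notinm v : v \in C j.+1 -> v \notin C j -> v \notin (A i + C j + B l)%VS.
Proof.
move=> vC vC'; apply: (notin_dim (transverse_dim tr (ltnW ijl))).
by rewrite !addvA (addvC <[v]>%VS) -(addvA (A i)) -(flag_step _ vC vC') ?transverse_dim //; lia.
Qed.

Lemma transverse_notinr v : v \in B l.+1 -> v \notin B l -> v \notin (A i + C j + B l)%VS.
Proof.
move=> vB vB'; apply: (notin_dim (transverse_dim tr (ltnW ijl))).
rewrite addvA (addvC <[v]>%VS) -(addvA (A i + C j)%VS).
by rewrite -(flag_step _ vB vB') ?transverse_dim //; lia.
Qed.

End Notin.

(** By induction on [s], [x] lies in [C (n - s) + B l]: by dimensions, this space meets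
    [A s.+1 + C (n - s.+1) + B l] exactly in [C (n - s.+1) + B l]. At [s = n] only [B l] is left. *)
Lemma transverse_cap A C B n l x : transverse A C B -> (n + l).+1 = k ->
  (forall i j, (i + j)%N = n -> x \in (A i + C j + B l)%VS) -> x \in B l.
Proof.
move=> tr nl xin.
have dimE i j l' : (i + j + l' <= k)%N -> \dim (A i + C j + B l') = (i + j + l')%N.
  exact: transverse_dim.
suff xCB s : (s <= n)%N -> x \in (C (n - s)%N + B l)%VS.
  by have := xCB n (leqnn n); rewrite subnn flag0 add0v.
have dCB j : (j + l <= k)%N -> \dim (C j + B l) = (j + l)%N.
  by move=> le; have := dimE 0 j l; rewrite flag0 add0v => ->.
elim: s => [_|s IHs sn]; first by have := xin 0 n; rewrite flag0 add0v subn0; apply.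
have ns : (n - s)%N = (n - s.+1).+1 by lia.
have CB : (C (n - s.+1)%N + B l)%VS
    = ((C (n - s)%N + B l) :&: (A s.+1 + C (n - s.+1)%N + B l))%VS.
  apply/eqP; rewrite eqEdim; apply/andP; split.
    rewrite subv_cap -addvA addvSr andbT addvS ?subvv //.
    by rewrite flag_mono //; lia.
  have /esym := dimv_sum_cap (C (n - s)%N + B l) (A s.+1 + C (n - s.+1)%N + B l).
  have -> : ((C (n - s)%N + B l) + (A s.+1 + C (n - s.+1)%N + B l)
      = A s.+1 + C (n - s)%N + B l)%VS.
    have sC : (C (n - s.+1)%N <= C (n - s)%N)%VS by rewrite flag_mono //; lia.
    by rewrite addv.[AC (2*(2*1)) (3*(1*4)*(2*5))] (addv_idPl sC) addvv.
  by rewrite !dCB ?dimE; lia.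
by rewrite CB memv_cap IHs ?xin; lia.
Qed.

(* Determined only up to a scalar, which cancels in each identity between values of psi. *)
Local Notation psi A C B i j l := (form_of_kernel (A i + C j + B l)%VS).

Lemma ker_psi A C B i j l : transverse A C B -> (i + j + l).+1 = k ->
  lker (psi A C B i j l) = (A i + C j + B l)%VS.
Proof. by move=> tr e; rewrite form_of_kernelP // transverse_dim //; lia. Qed.

(** The hypothesis cross-multiplies equal ratios of neighbouring [psi] at [b] and [b']. Hence all
    values at [b] are one multiple [c] of those at [b'], and [transverse_cap] puts [b - c *: b'] in
    [B l]. *)
Lemma flag_eq_step A C B B' l b b' :
  transverse A C B -> transverse A C B' -> (l < k)%N -> B l = B' l ->
  b \in B l.+1 -> b \notin B l -> b' \in B' l.+1 -> b' \notin B' l ->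
  (forall i j, (i + j + l + 2)%N = k ->
     psi A C B i j.+1 l b * psi A C B i.+1 j l b'
     = psi A C B i j.+1 l b' * psi A C B i.+1 j l b) ->
  B l.+1 = B' l.+1.
Proof.
move=> tr tr' lk Bl bB bB' b'B b'B' rat.
(* [n] is the value of [i + j] for which [A i + C j + B l] is a hyperplane. *)
pose n := (k - l.+1)%N; pose f i := psi A C B i (n - i)%N l.
have kerf i : (i <= n)%N -> lker (f i) = (A i + C (n - i)%N + B l)%VS.
  by move=> le; apply: ker_psi => //; rewrite /n; lia.
have fb i : (i <= n)%N -> f i b != 0 :> F.
  move=> le; rewrite -memv_ker_form kerf //.
  by apply: transverse_notinr => //; rewrite /n; lia.
have fb' i : (i <= n)%N -> f i b' != 0 :> F.
  move=> le; rewrite -memv_ker_form kerf // Bl.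
  by apply: transverse_notinr => //; rewrite /n; lia.
set c := f 0 b / f 0 b'.
have c0 : c != 0 by rewrite mulf_neq0 ?invr_eq0 ?fb ?fb'.
have fbE i : (i <= n)%N -> f i b = c * f i b' :> F.
  elim: i => [|i IHi] le; first by rewrite mulfVK ?fb'.
  have := rat i (n - i.+1)%N.
  have -> : (n - i.+1).+1 = (n - i)%N by lia.
  rewrite -/(f i) -/(f i.+1) => /(_ _)/wrap[|e]; first by rewrite /n; lia.
  by apply: (mulfI (fb' i (ltnW le))); rewrite -e IHi ?(ltnW le) // mulrA (mulrC c).
have bcb' : b - c *: b' \in B l.
  apply: (@transverse_cap A C B n) => //; first by rewrite /n; lia.
  move=> i j ij; have -> : j = (n - i)%N by lia.
  rewrite -kerf; last by lia.
  by rewrite memv_ker_form formB formZ fbE ?subrr //; lia.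
apply/esym/eqP; rewrite eqEdim !flag_dim // leqnn andbT.
rewrite (flag_step lk b'B b'B') -Bl subv_add flag_sub // andbT -memvE.
rewrite -(scalerK c0 b') rpredZ //.
by rewrite -(opprK (c *: b')) -[- (c *: b')](addKr b) opprD opprK rpredB // (subvP (flag_sub _ lk)).
Qed.

(** Modulo [A i + C j + B l], of codimension 2, [va] and [vc] form a basis; each [psi] vanishes at
    one of them, so the two are proportional to the dual basis. This expands [f] in that dual basis,
    with denominators cleared. *)
Lemma form_triangle A C B i j l (f : 'Hom(V, F^o)) va vc x :
  transverse A C B -> (i + j + l + 2)%N = k ->
  va \in A i.+1 -> va \notin A i -> vc \in C j.+1 -> vc \notin C j ->
  (A i + C j + B l <= lker f)%VS ->
  f x * psi A C B i j.+1 l va * psi A C B i.+1 j l vc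
  = f va * psi A C B i j.+1 l x * psi A C B i.+1 j l vc
    + f vc * psi A C B i.+1 j l x * psi A C B i j.+1 l va.
Proof.
move=> tr ijl vaA vaA' vcC vcC' /subvP sf.
have : x \in (A i.+1 + C j.+1 + B l)%VS by rewrite tr ?memvf //; lia.
have -> : (A i.+1 + C j.+1 + B l = <[va]> + <[vc]> + (A i + C j + B l))%VS.
  rewrite (flag_step _ vaA vaA') ?(flag_step _ vcC vcC'); try lia.
  by rewrite !addvA -(addvA _ (A i)) (addvC (A i)) !addvA.
case/memv_addP=> _ /memv_addP[_ /vlineP[a ->] [_ /vlineP[c ->] ->]] [w wW ->].
set p1 := psi A C B i j.+1 l; set p2 := psi A C B i.+1 j l.
have k1 : lker p1 = (A i + C j.+1 + B l)%VS by apply: ker_psi => //; lia.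
have k2 : lker p2 = (A i.+1 + C j + B l)%VS by apply: ker_psi => //; lia.
have f0 : f w = 0 :> F by apply/eqP; rewrite -memv_ker_form sf.
have p1w : p1 w = 0 :> F.
  apply/eqP; rewrite -memv_ker_form k1; apply: subvP wW.
  by rewrite !addvS ?subvv // flag_sub //; lia.
have p2w : p2 w = 0 :> F.
  apply/eqP; rewrite -memv_ker_form k2; apply: subvP wW.
  by rewrite !addvS ?subvv // flag_sub //; lia.
have p1c : p1 vc = 0 :> F.
  apply/eqP; rewrite -memv_ker_form k1; apply: subvP vcC.
  by rewrite (addvC (A i)) -addvA addvSl.
have p2a : p2 va = 0 :> F.
  apply/eqP; rewrite -memv_ker_form k2; apply: subvP vaA.
  by rewrite -addvA addvSl.
rewrite !formD !formZ f0 p1w p2w p1c p2a; ring.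
Qed.

(** This is the case [l = 0]. The cross ratio is [p2 d * p1 b / (p2 b * p1 d)]; the factors at [d]
    are common to both flags, which leaves equal ratios of [p1] and [p2] at [b] and [b']. *)
Lemma cross_ratios_determine_line A B B' C D :
  (0 < k)%N ->
  transverse A C B -> transverse A C B' -> transverse A C D ->
  (forall i j, (i + j + 2)%N = k ->
     cross_ratio_proj A B C D i j = cross_ratio_proj A B' C D i j) ->
  B 1%N = B' 1%N.
Proof.
move=> k0 tr tr' trD cr.
have [b bB bB'] := flag_vector B k0; have [b' b'B b'B'] := flag_vector B' k0.
have [d dD dD'] := flag_vector D k0.
apply: (flag_eq_step tr tr' k0 _ bB bB' b'B b'B') => [|i j ij]; first by rewrite !flag0.
have [e1 e2] : (i + j.+1 + 0).+1 = k /\ (i.+1 + j + 0).+1 = k by lia.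
rewrite addn0 in ij; set p1 := psi A C B i j.+1 0%N; set p2 := psi A C B i.+1 j 0%N.
(* All flags are zero at index 0, so the kernels may be read with [D 0]; nonvanishing at [d] then
   follows from [trD]. *)
have k1 : lker p1 = (A i + C j.+1 + D 0%N)%VS by rewrite ker_psi ?flag0.
have k2 : lker p2 = (A i.+1 + C j + D 0%N)%VS by rewrite ker_psi ?flag0.
have p1d : p1 d != 0 :> F.
  by rewrite -memv_ker_form k1; apply: (transverse_notinr _ (eq_leq e1)).
have p2d : p2 d != 0 :> F.
  by rewrite -memv_ker_form k2; apply: (transverse_notinr _ (eq_leq e2)).
have p2b : p2 b != 0 :> F.
  by rewrite -memv_ker_form ker_psi //; apply: (transverse_notinr _ (eq_leq e2)).
have p2b' : p2 b' != 0 :> F.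
  by rewrite -memv_ker_form k2 !flag0 -(flag0 B'); apply: (transverse_notinr _ (eq_leq e2)).
rewrite flag0 addv0 in k1; rewrite flag0 addv0 in k2.
rewrite flag0 memv0 in dD'; rewrite flag0 memv0 in bB'; rewrite flag0 memv0 in b'B'.
have := cr i j ij.
rewrite (cross_ratio_projE ij tr trD k2 k1 bB bB' dD dD').
rewrite (cross_ratio_projE ij tr' trD k2 k1 b'B b'B' dD dD').
move/eqP; rewrite eqr_div ?mulf_neq0 // => /eqP e.
have n0 : p2 d * p1 d != 0 by rewrite mulf_neq0.
by apply: (mulfI n0); move: e; rewrite !mulrA => e; ring: e.
Qed.

(** The factors from [Fa] and [Fc] are common to both flags, so the triple ratio determines
    [Fb vc / Fb va]. Since [Fb b = 0], [form_triangle] converts this quotient into the ratio of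
    [p1 b] and [p2 b] that [flag_eq_step] asks for. *)
Lemma triple_ratios_determine_step A B B' C l :
  (l.+1 < k)%N -> transverse A C B -> transverse A C B' ->
  B l = B' l -> B l.+1 = B' l.+1 ->
  (forall i j, (i + j + l + 3)%N = k ->
     triple_ratio_proj A B C i j l = triple_ratio_proj A B' C i j l) ->
  B l.+2 = B' l.+2.
Proof.
move=> lk tr tr' Bl Bl1 tri.
have [b bB bB'] := flag_vector B lk; have [b' b'B b'B'] := flag_vector B' lk.
have [v vB vB'] := flag_vector B (ltnW lk).
apply: (flag_eq_step tr tr' lk Bl1 bB bB' b'B b'B') => i j ij.
have [ea eb ec] : [/\ (i.+2 + j + l).+1 = k, (i + j + l.+2).+1 = k
  & (i + j.+2 + l).+1 = k] by split; lia.
have [e1 e2] : (i + j.+1 + l.+1).+1 = k /\ (i.+1 + j + l.+1).+1 = k by lia.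
(* [flag_eq_step] is used at level [l.+1]: its condition [i + j + l.+1 + 2 = k] is that of the
   triple ratio with indices [i], [j], [l]. *)
have [[ik jk] [ijl ij1]] : ((i < k)%N /\ (j < k)%N) /\
  ((i + j + l + 3)%N = k /\ (i + j + l.+1 + 2)%N = k) by lia.
have [va vaA vaA'] := flag_vector A ik; have [vc vcC vcC'] := flag_vector C jk.
set Fa := psi A C B i.+2 j l; set Fc := psi A C B i j.+2 l.
set Fb := psi A C B i j l.+2; set Fb' := psi A C B' i j l.+2.
have ka : lker Fa = (A i.+2 + C j + B l)%VS by exact: ker_psi.
have kc : lker Fc = (A i + C j.+2 + B l)%VS by exact: ker_psi.
have kb : lker Fb = (A i + C j + B l.+2)%VS by exact: ker_psi.
have kb' : lker Fb' = (A i + C j + B' l.+2)%VS by exact: ker_psi.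
have := tri i j ijl.
rewrite (triple_ratio_projE ijl tr ka kb kc vaA vaA' vB vB' vcC vcC').
(* [Fa], [Fc] and [v] involve only [B l] and [B l.+1], which [B'] shares, so the formula for [B']
   can use the same forms and vector. *)
rewrite Bl in ka kc vB'; rewrite Bl1 in vB.
rewrite (triple_ratio_projE ijl tr' ka kb' kc vaA vaA' vB vB' vcC vcC').
rewrite -Bl in ka kc vB'; rewrite -Bl1 in vB.
have Fav : Fa v != 0 :> F.
  by rewrite -memv_ker_form ka; apply: (transverse_notinr _ (eq_leq ea)).
have Fac : Fa vc != 0 :> F.
  by rewrite -memv_ker_form ka; apply: (transverse_notinm _ (eq_leq ea)).
have Fca : Fc va != 0 :> F.
  by rewrite -memv_ker_form kc; apply: (transverse_notinl _ (eq_leq ec)).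
have Fcv : Fc v != 0 :> F.
  by rewrite -memv_ker_form kc; apply: (transverse_notinr _ (eq_leq ec)).
have Fba : Fb va != 0 :> F.
  by rewrite -memv_ker_form kb; apply: (transverse_notinl _ (eq_leq eb)).
have Fbc : Fb vc != 0 :> F.
  by rewrite -memv_ker_form kb; apply: (transverse_notinm _ (eq_leq eb)).
have Fb'a : Fb' va != 0 :> F.
  by rewrite -memv_ker_form kb'; apply: (transverse_notinl _ (eq_leq eb)).
have Fb'c : Fb' vc != 0 :> F.
  by rewrite -memv_ker_form kb'; apply: (transverse_notinm _ (eq_leq eb)).
have sB : (A i + C j + B l.+1 <= lker Fb)%VS.
  by rewrite kb addvS ?subvv // flag_sub.
have sB' : (A i + C j + B l.+1 <= lker Fb')%VS.
  by rewrite kb' Bl1 addvS ?subvv // flag_sub.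
have := form_triangle b tr ij1 vaA vaA' vcC vcC' sB.
have := form_triangle b' tr ij1 vaA vaA' vcC vcC' sB'.
have -> : Fb b = 0 :> F.
  by apply/eqP; rewrite -memv_ker_form kb memvE (subv_trans _ (addvSr _ _)).
have -> : Fb' b' = 0 :> F.
  by apply/eqP; rewrite -memv_ker_form kb' memvE (subv_trans _ (addvSr _ _)).
set p1 := psi A C B i j.+1 l.+1; set p2 := psi A C B i.+1 j l.+1.
have p1a : p1 va != 0 :> F.
  by rewrite -memv_ker_form ker_psi //; apply: (transverse_notinl _ (eq_leq e1)).
have p2c : p2 vc != 0 :> F.
  by rewrite -memv_ker_form ker_psi //; apply: (transverse_notinm _ (eq_leq e2)).
rewrite !mul0r => r2 r1 /eqP; rewrite eqr_div ?mulf_neq0 // => /eqP e.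
have {}e : Fb vc * Fb' va = Fb' vc * Fb va :> F.
  have n0 : Fa v * Fc va * Fa vc * Fc v != 0 by rewrite !mulf_neq0.
  apply: (mulfI n0); ring: e.
have n0 : Fb va * Fb' vc * p1 va * p2 vc != 0 by rewrite !mulf_neq0.
apply: (mulfI n0).
have {}r1 : Fb va * p1 b * p2 vc = - (Fb vc * p2 b * p1 va) :> F.
  by apply/eqP; rewrite -addr_eq0 -r1.
have {}r2 : Fb' vc * p2 b' * p1 va = - (Fb' va * p1 b' * p2 vc) :> F.
  by apply/eqP; rewrite -addr_eq0 addrC -r2.
transitivity ((Fb va * p1 b * p2 vc) * (Fb' vc * p2 b' * p1 va)); first by ring.
rewrite r1 r2 mulrNN.
transitivity ((Fb vc * Fb' va) * (p2 b * p1 va * p1 b' * p2 vc)); first by ring.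
by rewrite e; ring.
Qed.

Lemma ratios_determine_flag A B B' C D :
  transverse A C B -> transverse A C B' -> transverse A C D ->
  (forall i j, (i + j + 2)%N = k ->
     cross_ratio_proj A B C D i j = cross_ratio_proj A B' C D i j) ->
  (forall i j l, (i + j + l + 3)%N = k ->
     triple_ratio_proj A B C i j l = triple_ratio_proj A B' C i j l) ->
  forall j, (j <= k)%N -> B j = B' j.
Proof.
move=> tr tr' trD cr tri.
(* The triple ratio step needs agreement at two consecutive indices, so the induction carries
   both. *)
suff P j : (j < k)%N -> B j = B' j /\ B j.+1 = B' j.+1.
  by case=> [|j] jk; [rewrite !flag0 | case: (P j jk)].
elim: j => [|j IHj] jk; split; rewrite ?flag0 //.
- exact: (cross_ratios_determine_line jk tr tr' trD cr).
- by case: (IHj (ltnW jk)).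
have [Bj Bj1] := IHj (ltnW jk).
by apply: (triple_ratios_determine_step jk tr tr' Bj Bj1) => i l; apply: tri.
Qed.

End Uniqueness.

(** * Semilinear involutions acting on subspaces, forms, flags and ratios *)

Section Semilinear.
Variables (F : fieldType) (th : {rmorphism F -> F}) (k : nat).
Local Notation V := 'cV[F]_k.
Variable sig : V -> V.
Implicit Types (U W : {vspace V}) (A B C D : flag F k).

Definition semilinear_involution : Prop :=
  [/\ {morph sig : u v / u + v}, forall a v, sig (a *: v) = th a *: sig v
    & involutive sig].

Hypotheses (thK : involutive th) (sigP : semilinear_involution).

Let sigD : {morph sig : u v / u + v}. Proof. by case: sigP. Qed.
Let sigZ a v : sig (a *: v) = th a *: sig v. Proof. by case: sigP. Qed.
Let sigK : involutive sig. Proof. by case: sigP. Qed.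

Lemma semilinear0 : sig 0 = 0.
Proof. by rewrite -(scale0r 0) sigZ rmorph0 !scale0r. Qed.

Lemma semilinear_sum I (r : seq I) (P : pred I) (E : I -> V) :
  sig (\sum_(i <- r | P i) E i) = \sum_(i <- r | P i) sig (E i).
Proof. exact: (big_morph sig sigD semilinear0). Qed.

Lemma semilinear_eq0 v : (sig v == 0) = (v == 0).
Proof.
by apply/eqP/eqP => [e|->]; rewrite ?semilinear0 // -[v]sigK e semilinear0.
Qed.

(** [U'] is the image of [U]: as [sig] is its own inverse, membership in the image is tested by
    applying [sig] again. *)
Definition sig_image U U' : Prop := forall x, (x \in U') = (sig x \in U).

Lemma sig_image_sym U U' : sig_image U U' -> sig_image U' U.
Proof. by move=> h x; rewrite h sigK. Qed.

Lemma sig_image0 : sig_image 0 0.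
Proof. by move=> x; rewrite !memv0 semilinear_eq0. Qed.

Lemma sig_image_full : sig_image fullv fullv.
Proof. by move=> x; rewrite !memvf. Qed.

Lemma sig_image_add U U' W W' :
  sig_image U U' -> sig_image W W' -> sig_image (U + W) (U' + W').
Proof.
move=> hU hW x; apply/memv_addP/memv_addP => [[u uU [w wW ->]]|[u uU [w wW e]]].
  by exists (sig u); rewrite -?hU //; exists (sig w); rewrite -?hW ?sigD.
exists (sig u); rewrite ?hU ?sigK //; exists (sig w); rewrite ?hW ?sigK //.
by rewrite -sigD -e sigK.
Qed.

Lemma sig_image_sum (I : finType) (P : pred I) (E E' : I -> {vspace V}) :
  (forall i, P i -> sig_image (E i) (E' i)) ->
  sig_image (\sum_(i | P i) E i) (\sum_(i | P i) E' i).
Proof.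
move=> hE; elim/big_rec2: _ => [|i U U' Pi]; first exact: sig_image0.
by apply: sig_image_add; apply: hE.
Qed.

Lemma sig_image_line m m' c : c != 0 -> sig m' = c *: m ->
  sig_image <[m]> <[m']>.
Proof.
move=> c0 e x; apply/vlineP/vlineP => [[a ->]|[a xE]].
  by exists (th a * c); rewrite sigZ e scalerA.
exists (th a / th c); rewrite -[x]sigK xE sigZ.
have -> : m = c^-1 *: sig m' by rewrite e scalerK.
by rewrite sigZ sigK fmorphV scalerA.
Qed.

Lemma eq_sig_image U U' U'' : sig_image U U' -> sig_image U U'' -> U' = U''.
Proof. by move=> h h'; apply/vspaceP => x; rewrite h h'. Qed.

(** The image is spanned by the images of a basis, so the dimension does not grow; a second
    application returns to [U], so it does not drop either. *)
Lemma exists_sig_image U : exists2 U', sig_image U U' & \dim U' = \dim U.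
Proof.
pose im W := <<[seq sig e | e <- vbasis W]>>%VS.
have imP W : sig_image W (im W).
  move=> x; apply/idP/idP.
    rewrite /im => /coord_span ->; rewrite semilinear_sum rpred_sum // => i _.
    rewrite sigZ rpredZ // (nth_map 0) ?sigK ?size_tuple //.
    by rewrite vbasis_mem // mem_nth // size_tuple.
  rewrite -[W in X in X -> _](span_basis (vbasisP W)) => /coord_span xE.
  rewrite -[x]sigK xE semilinear_sum rpred_sum // => i _.
  rewrite sigZ rpredZ // memv_span // map_f // mem_nth //.
  by rewrite size_tuple.
have dim_im W : (\dim (im W) <= \dim W)%N.
  by apply: leq_trans (dim_span _) _; rewrite size_map size_tuple.
exists (im U); first exact: imP.
apply/eqP; rewrite eqn_leq dim_im.
have {1}-> : U = im (im U); last exact: dim_im.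
exact: eq_sig_image (sig_image_sym (imP U)) (imP _).
Qed.

Definition flag_image A A' : Prop := forall j, (j <= k)%N -> sig_image (A j) (A' j).

Lemma exists_flag_image A : exists A', flag_image A A'.
Proof.
have ex j : exists U, sig_image (A j) U /\ \dim U = \dim (A j).
  by have [U h d] := exists_sig_image (A j); exists U.
have [U UP] := boolp.choice ex.
have dU j : (j <= k)%N -> \dim (U j) = j.
  by move=> jk; case: (UP j) => _ ->; rewrite flag_dim.
have sU j : (j < k)%N -> (U j <= U j.+1)%VS.
  move=> jk; apply/subvP => x; case: (UP j) => -> _; case: (UP j.+1) => -> _.
  exact/subvP/flag_sub.
by exists (Flag dU sU) => j _; case: (UP j).
Qed.

Lemma transverse_image A B C A' B' C' :
  flag_image A A' -> flag_image B B' -> flag_image C C' ->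
  transverse A C B -> transverse A' C' B'.
Proof.
move=> hA hB hC tr i j l ijl; apply: eq_sig_image sig_image_full.
rewrite -(tr i j l ijl); apply: sig_image_add; first apply: sig_image_add.
- by apply: hA; lia.
- by apply: hC; lia.
- by apply: hB; lia.
Qed.

(** [f] after [sig] is only semilinear; applying the involution [th] to its values restores
    linearity. *)
Lemma conj_form (f : 'Hom(V, F^o)) :
  exists g : 'Hom(V, F^o), forall v, g v = th (f (sig v)) :> F.
Proof.
pose h v : F^o := th (f (sig v)).
have hL : linear h.
  by move=> a u v; rewrite /h sigD sigZ formD formZ rmorphD rmorphM thK.
pose hB := GRing.isLinear.Build F V F^o _ h hL.
pose D : {linear V -> F^o} := HB.pack h hB.
by exists (linfun D) => v; rewrite lfunE.
Qed.

Lemma conj_form_ker (f : 'Hom(V, F^o)) U' :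
  sig_image (lker f) U' ->
  exists2 g : 'Hom(V, F^o), lker g = U' & forall v, g (sig v) = th (f v) :> F.
Proof.
move=> h; have [g gE] := conj_form f; exists g => [|v]; last by rewrite gE sigK.
apply/vspaceP => x; rewrite h !memv_ker_form gE.
by rewrite fmorph_eq0.
Qed.

Lemma hyperplane_form A B C i j l : transverse A C B -> (i + j + l).+1 = k ->
  exists f : 'Hom(V, F^o), lker f = (A i + C j + B l)%VS.
Proof.
by move=> tr e; apply: exists_form_with_kernel; rewrite dim_cV transverse_dim //; lia.
Qed.

Lemma mem_image U U' v : sig_image U U' -> v \in U -> sig v \in U'.
Proof. by move=> h vU; rewrite h sigK. Qed.

Lemma notin_image U U' v : sig_image U U' -> v \notin U -> sig v \notin U'.
Proof. by move=> h vU; rewrite h sigK. Qed.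

Section RatioImage.
Variables A B C A' B' C' : flag F k.
Hypotheses (hA : flag_image A A') (hB : flag_image B B') (hC : flag_image C C').
Hypothesis tr : transverse A C B.

(** Compute the ratio of the image flags with transported vectors and forms, for which
    [g (sig v) = th (f v)]: every factor is replaced by its value under [th]. *)
Lemma cross_ratio_proj_image D D' i j :
  flag_image D D' -> transverse A C D -> (i + j + 2)%N = k ->
  cross_ratio_proj A' B' C' D' i j = th (cross_ratio_proj A B C D i j).
Proof.
move=> hD trD ij.
have [e1 e2] : (i.+1 + j + 0).+1 = k /\ (i + j.+1 + 0).+1 = k by lia.
have [fa ka] := hyperplane_form tr e1; have [fc kc] := hyperplane_form tr e2.
rewrite flag0 addv0 in ka; rewrite flag0 addv0 in kc.
have [k0 i1 j1] : [/\ (0 < k)%N, (i.+1 <= k)%N & (j.+1 <= k)%N] by split; lia.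
have [b bB bB'] := flag_vector B k0; have [d dD dD'] := flag_vector D k0.
have [|ga ka' gaE] := @conj_form_ker fa (A' i.+1 + C' j)%VS.
  by rewrite ka; apply: sig_image_add; [exact: hA | apply: hC; exact: ltnW].
have [|gc kc' gcE] := @conj_form_ker fc (A' i + C' j.+1)%VS.
  by rewrite kc; apply: sig_image_add; [apply: hA; exact: ltnW | exact: hC].
rewrite flag0 memv0 in bB'; rewrite flag0 memv0 in dD'.
rewrite (cross_ratio_projE ij tr trD ka kc bB bB' dD dD').
have tr' := transverse_image hA hB hC tr; have trD' := transverse_image hA hD hC trD.
rewrite (cross_ratio_projE ij tr' trD' ka' kc' (mem_image (hB k0) bB) _
  (mem_image (hD _ k0) dD)) ?semilinear_eq0 //.
by rewrite !gaE !gcE fmorph_div !rmorphM.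
Qed.

Lemma triple_ratio_proj_image i j l : (i + j + l + 3)%N = k ->
  triple_ratio_proj A' B' C' i j l = th (triple_ratio_proj A B C i j l).
Proof.
move=> ijl.
have [ea eb ec] : [/\ (i.+2 + j + l).+1 = k, (i + j + l.+2).+1 = k
  & (i + j.+2 + l).+1 = k] by split; lia.
have [i0 j0 l0] : [/\ (i <= k)%N, (j <= k)%N & (l <= k)%N] by split; lia.
have [i1 j1 l1] : [/\ (i < k)%N, (j < k)%N & (l < k)%N] by split; lia.
have [i2 j2 l2] : [/\ (i.+1 < k)%N, (j.+1 < k)%N & (l.+1 < k)%N] by split; lia.
have [fa ka] := hyperplane_form tr ea; have [fb kb] := hyperplane_form tr eb.
have [fc kc] := hyperplane_form tr ec.
have [a aA aA'] := flag_vector A i1; have [b bB bB'] := flag_vector B l1.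
have [c cC cC'] := flag_vector C j1.
have [|ga ka' gaE] := @conj_form_ker fa (A' i.+2 + C' j + B' l)%VS.
  by rewrite ka; do 2?apply: sig_image_add; [exact: hA | exact: hC | exact: hB].
have [|gb kb' gbE] := @conj_form_ker fb (A' i + C' j + B' l.+2)%VS.
  by rewrite kb; do 2?apply: sig_image_add; [exact: hA | exact: hC | exact: hB].
have [|gc kc' gcE] := @conj_form_ker fc (A' i + C' j.+2 + B' l)%VS.
  by rewrite kc; do 2?apply: sig_image_add; [exact: hA | exact: hC | exact: hB].
rewrite (triple_ratio_projE ijl tr ka kb kc aA aA' bB bB' cC cC').
have tr' := transverse_image hA hB hC tr.
rewrite (triple_ratio_projE ijl tr' ka' kb' kc'
  (mem_image (hA i1) aA) (notin_image (hA i0) aA')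
  (mem_image (hB l1) bB) (notin_image (hB l0) bB')
  (mem_image (hC j1) cC) (notin_image (hC j0) cC')).
by rewrite !gaE !gbE !gcE fmorph_div !rmorphM.
Qed.

End RatioImage.
End Semilinear.

(** * Eigenbases and simple eigenvalues *)

Section Eigendirections.
Variables (F : fieldType) (k : nat).
Implicit Types (M : 'M[F]_k) (lam : 'I_k -> F) (m : 'I_k -> 'cV[F]_k).

Lemma eigendirections_expand M lam m v : ordered_eigendirections M lam m ->
  exists c : 'I_k -> F, v = \sum_j c j *: m j.
Proof.
case=> /andP[/eqP sp _] _; have : v \in <<[tuple m j | j < k]>>%VS by rewrite sp memvf.
move/coord_span => ->; exists (fun j => coord [tuple m j | j < k] j v).
by apply: eq_bigr => j _; rewrite (nth_map j) ?size_enum_ord // nth_ord_enum.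
Qed.

Lemma eigendirections_free M lam m (c d : 'I_k -> F) :
  ordered_eigendirections M lam m ->
  \sum_j c j *: m j = \sum_j d j *: m j -> c =1 d.
Proof.
case=> /andP[_ fr] _ e j.
have co (b : 'I_k -> F) : coord [tuple m j | j < k] j (\sum_j b j *: m j) = b j.
  rewrite -[RHS](coord_sum_free b j fr); congr (coord _ _ _).
  by apply: eq_bigr => i _; rewrite (nth_map i) ?size_enum_ord // nth_ord_enum.
by rewrite -co e co.
Qed.

Lemma eigendirection_neq0 M lam m j : ordered_eigendirections M lam m -> m j != 0.
Proof.
case=> /andP[_ fr] _; apply: contraTneq fr => m0.
have : 0 \in [tuple m j | j < k] by apply/mapP; exists j; rewrite ?mem_enum.
by move=> in0; apply/negP => /free_not0/(_ in0); rewrite eqxx.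
Qed.

(** The matrix [P] with columns [m j] satisfies [M *m P = P *m L] with [L] diagonal. It is
    invertible by freeness, so its determinant cancels from the same relation between characteristic
    matrices. *)
Lemma char_poly_eigendirections M lam m : ordered_eigendirections M lam m ->
  char_poly M = \prod_(a <- [seq lam j | j <- enum 'I_k]) ('X - a%:P).
Proof.
move=> Mm; have [_ Me] := Mm.
pose P : 'M[F]_k := \matrix_(i, j) m j i 0.
have mP v : P *m v = \sum_j v j 0 *: m j.
  apply/colP => i; rewrite !mxE summxE; apply: eq_bigr => j _.
  by rewrite !mxE mulrC.
have uP : P \in unitmx.
  rewrite -unitmx_tr -row_free_unit -kermx_eq0; apply/eqP/row_matrixP => i.
  rewrite row0; set w := row i _.
  have : w *m P^T = 0 by rewrite /w -row_mul mulmx_ker row0.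
  move/(congr1 trmx); rewrite trmx_mul trmxK trmx0 mP => e.
  apply/rowP => j; rewrite mxE.
  have := @eigendirections_free M lam m (fun j => w^T j 0) (fun=> 0) Mm.
  rewrite e [X in _ = X -> _]big1 => [/(_ erefl j)|j' _]; last by rewrite scale0r.
  by rewrite [w^T _ _]mxE [w 0 j]mxE => ->; rewrite mxE.
pose L : 'M[F]_k := diag_mx (\row_j lam j).
have MP : M *m P = P *m L.
  apply/matrixP => i j; rewrite mul_mx_diag !mxE.
  have := congr1 (fun v : 'cV_k => v i 0) (Me j); rewrite !mxE mulrC => <-.
  by apply: eq_bigr => s _; rewrite !mxE.
have chP : char_poly_mx M *m map_mx polyC P = map_mx polyC P *m char_poly_mx L.
  rewrite /char_poly_mx mulmxBl mulmxBr -!map_mxM MP.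
  by rewrite scalar_mxC.
have -> : char_poly M = char_poly L.
  have /(congr1 determinant) := chP; rewrite !det_mulmx mulrC => /mulfI; apply.
  by rewrite det_map_mx polyC_eq0 -unitfE -unitmxE.
rewrite char_poly_trig ?diag_mx_is_trig // big_map big_enum /=.
by apply: eq_bigr => j _; rewrite !mxE eqxx mulr1n.
Qed.

Lemma eigenvalueP_eigendirections M lam m a : ordered_eigendirections M lam m ->
  reflect (exists j, a = lam j) (eigenvalue M a).
Proof.
move=> Mm; rewrite eigenvalue_root_char (char_poly_eigendirections Mm) root_prod_XsubC.
apply: (iffP mapP) => [[j _ ->]|[j ->]]; exists j => //.
by rewrite mem_enum.
Qed.

Lemma eigenvalue_vector M a (v : 'cV[F]_k) : v != 0 -> M *m v = a *: v -> eigenvalue M a.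
Proof.
move=> v0 Mv; rewrite /eigenvalue /eigenspace kermx_eq0 row_free_unit.
apply: contraNN v0 => uM; rewrite -[v](mulKmx uM) mulmxBl Mv mul_scalar_mx.
by rewrite subrr mulmx0.
Qed.

(** The multiplicity of a root of [char_poly M] is the number of its occurrences among the
    [lam j]. *)
Lemma simple_eigenvalues_inj M lam m : ordered_eigendirections M lam m ->
  (forall a, eigenvalue M a -> mup a (char_poly M) = 1%N) -> injective lam.
Proof.
move=> Mm simple; apply/injectiveP; rewrite /injectiveb /dinjectiveb.
apply: count_mem_uniq => a.
have [al|/count_memPn -> //] := boolP (a \in _); rewrite -mu_prod_XsubC.
rewrite -(char_poly_eigendirections Mm) simple //.
by apply/(eigenvalueP_eigendirections a Mm); have /mapP[j _ ->] := al; exists j.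
Qed.

(** Comparing coordinates of [M *m v] and [lam j *: v] makes [lam s - lam j] times the coordinate
    [c s] vanish for every [s]. *)
Lemma eigenvector_line M lam m j v : ordered_eigendirections M lam m ->
  injective lam -> M *m v = lam j *: v -> exists c, v = c *: m j.
Proof.
move=> Mm lam_inj Mv; have [c vE] := eigendirections_expand v Mm.
exists (c j); rewrite vE (bigD1 j) //= big1 ?addr0 // => s sj.
have [_ Me] := Mm.
have := @eigendirections_free M lam m (fun s => lam s * c s) (fun s => lam j * c s) Mm.
case/(_ _ s)/wrap=> [|/eqP].
  transitivity (M *m v).
    rewrite vE mulmx_sumr; apply: eq_bigr => t _.
    by rewrite -scalemxAr Me scalerA mulrC.
  by rewrite Mv vE scaler_sumr; apply: eq_bigr => t _; rewrite scalerA.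
rewrite -subr_eq0 -mulrBl mulf_eq0 subr_eq0 (inj_eq lam_inj) (negbTE sj) /=.
by move/eqP->; rewrite scale0r.
Qed.

Lemma mem_sum_directions (P : pred 'I_k) m v :
  v \in (\sum_(s < k | P s) <[m s]>)%VS ->
  exists2 c : 'I_k -> F, v = \sum_s c s *: m s & forall s, ~~ P s -> c s = 0.
Proof.
case/memv_sumP => u uP ->.
pose r s a : Prop := if P s then u s = a *: m s else a = 0.
have ex s : exists a, r s a.
  by rewrite /r; case: (boolP (P s)) => Ps; [apply/vlineP/uP | exists 0].
have [c cP] := boolp.choice ex; exists c => [|s Ps]; last first.
  by have := cP s; rewrite /r (negbTE Ps).
rewrite big_mkcond /=; apply: eq_bigr => s _.
by have := cP s; rewrite /r; case: ifP => // _ ->; rewrite scale0r.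
Qed.

(** Coordinates are unique, so those of [v] vanish outside [P] and outside [Q]; only the one at [j]
    can survive. *)
Lemma mem_sum_directionsI M lam m j (P Q : pred 'I_k) v :
  ordered_eigendirections M lam m -> (forall s, P s && Q s -> s = j) ->
  v \in (\sum_(s < k | P s) <[m s]>)%VS -> v \in (\sum_(s < k | Q s) <[m s]>)%VS ->
  exists c, v = c *: m j.
Proof.
move=> Mm PQ /mem_sum_directions[c vc cP] /mem_sum_directions[d vd dQ].
exists (c j); rewrite {1}vc (bigD1 j) //= big1 ?addr0 // => s sj.
have [Ps|/cP ->] := boolP (P s); last by rewrite scale0r.
have [Qs|/dQ d0] := boolP (Q s).
  by rewrite (PQ s) ?Ps // eqxx in sj.
have cd : c =1 d by apply: (eigendirections_free Mm); rewrite -vc.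
by rewrite cd d0 scale0r.
Qed.

End Eigendirections.

(** * Intertwining of conjugate matrices *)

Section Intertwining.
Variables (F : fieldType) (n : nat).
Implicit Types (G M N : 'M[F]_n).

Lemma eq_scale_mulmx M N d :
  (forall v : 'cV_n, M *m v = d *: (N *m v)) -> M = d *: N.
Proof.
move=> h; apply/matrixP => i j; have := h (delta_mx j 0).
by rewrite -!colE => /colP/(_ i); rewrite !mxE.
Qed.

(** Meant for [G'] the complex conjugate of [G], so that [G *m invmx G'] is the linear part of
    [sigma G]; with [N] real and [a] conjugate to [b], it relates a matrix to its complex
    conjugate. *)
Lemma conjugates_intertwine G G' N a b : G \in unitmx -> G' \in unitmx -> b != 0 ->
  G *m invmx G' *m (a *: (G' *m N *m invmx G'))
  = (a / b) *: (b *: (G *m N *m invmx G) *m (G *m invmx G')).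
Proof.
move=> uG uG' b0; rewrite -scalemxAr -scalemxAl scalerA mulfVK //.
by rewrite !mulmxA !mulmxKV.
Qed.

Lemma intertwined_conjugates G G' M M' d : G \in unitmx -> G' \in unitmx ->
  G *m invmx G' *m M' = d *: (M *m (G *m invmx G')) ->
  invmx G' *m M' *m G' = d *: (invmx G *m M *m G).
Proof.
move=> uG uG' e; have -> : invmx G' *m M' = invmx G *m (G *m invmx G' *m M').
  by rewrite !mulmxA mulVmx // mul1mx.
by rewrite e -scalemxAr -scalemxAl !mulmxA mulmxKV.
Qed.

End Intertwining.

(** * Real forms, antilinear involutions and reflections of eigenvalues *)

Section RealStructure.
Variables (R : realType) (k : nat).
Local Notation K := R[i].
Local Notation conj := (@conjc R : {rmorphism K -> K}).
Implicit Types (Gam M : 'M[K]_k) (u a b c : K) (m v : 'cV[K]_k).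

(* The antilinear involution of C^k whose fixed points are Gam R^k. *)
Definition sigma Gam v : 'cV[K]_k :=
  Gam *m invmx (map_mx conj Gam) *m map_mx conj v.

Lemma map_conjK n p (A : 'M[K]_(n, p)) : map_mx conj (map_mx conj A) = A.
Proof. by apply/matrixP => i j; rewrite !mxE /= conjcK. Qed.

Lemma conjc_fixed_real a : conjc a = a -> (Re a)%:C = a.
Proof. by move=> e; rewrite ReJ_add e; field. Qed.

Lemma sigma_involution Gam : Gam \in unitmx -> semilinear_involution conj (sigma Gam).
Proof.
move=> uG; have uG' : map_mx conj Gam \in unitmx by rewrite map_unitmx.
split=> [v w|a v|v]; rewrite /sigma.
- by rewrite map_mxD mulmxDr.
- by rewrite map_mxZ -scalemxAr.
rewrite !map_mxM map_conjK map_invmx map_conjK -!mulmxA (mulmxA (invmx (map_mx _ _))).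
by rewrite mulVmx // mul1mx mulKVmx.
Qed.

(* With N = Gam^-1 M Gam the condition reads conj N = (conj c / c) N,
   i.e. N / c is a real matrix. *)
Definition sigma_semicommutes Gam M c : Prop :=
  c != 0 /\ forall v, sigma Gam (M *m v) = (conjc c / c) *: (M *m sigma Gam v).

Lemma in_PGLR_semicommutes Gam M : Gam \in unitmx ->
  in_PGLR (invmx Gam *m M *m Gam) -> exists c, sigma_semicommutes Gam M c.
Proof.
move=> uG [c [c0 [N [_ NE]]]]; exists c; split=> // v.
have uG' : map_mx conj Gam \in unitmx by rewrite map_unitmx.
have ME : M = c *: (Gam *m map_mx (real_complex R) N *m invmx Gam).
  by rewrite scalemxAl scalemxAr -NE !mulmxA mulmxV // mul1mx mulmxK.
have NR : map_mx conj (map_mx (real_complex R) N) = map_mx (real_complex R) N.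
  by apply/matrixP => i j; rewrite !mxE /= oppr0.
have cME : map_mx conj M = conjc c *: (map_mx conj Gam *m map_mx (real_complex R) N
    *m invmx (map_mx conj Gam)).
  by rewrite ME map_mxZ !map_mxM map_invmx NR.
have := conjugates_intertwine (map_mx (real_complex R) N) (conjc c) uG uG' c0.
rewrite -cME -ME /sigma map_mxM => e.
by rewrite [LHS]mulmxA e -scalemxAl; congr (_ *: _); rewrite !mulmxA.
Qed.

Lemma semicommutes_in_PGLR Gam M c : Gam \in unitmx -> M \in unitmx ->
  sigma_semicommutes Gam M c -> in_PGLR (invmx Gam *m M *m Gam).
Proof.
move=> uG uM [c0 cM]; set N := invmx Gam *m M *m Gam.
have uG' : map_mx conj Gam \in unitmx by rewrite map_unitmx.
have NE : map_mx conj N = (conjc c / c) *: N.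
  have e : Gam *m invmx (map_mx conj Gam) *m map_mx conj M
         = (conjc c / c) *: (M *m (Gam *m invmx (map_mx conj Gam))).
    (* Evaluating at the conjugate of [v] undoes the conjugation inside [sigma], which leaves an
       identity of matrices. *)
    apply: eq_scale_mulmx => v; have := cM (map_mx conj v).
    by rewrite /sigma map_mxM !map_conjK !mulmxA.
  rewrite /N !map_mxM map_invmx; exact: intertwined_conjugates e.
(* By [NE] the entries of [c^-1 *: N] are their own conjugates, so taking real parts does not change
   them. *)
exists c; split=> //; exists (map_mx (@Re R) (c^-1 *: N)).
have NR : N = c *: map_mx (real_complex R) (map_mx (@Re R) (c^-1 *: N)).
  apply: (canRL (scalerKV c0)); apply/matrixP => i j; rewrite 2![in RHS]mxE.
  set z := (c^-1 *: N) i j.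
  have zR : conjc z = z.
    have /matrixP/(_ i j) := NE; rewrite mxE [in RHS]mxE /= => Nij.
    rewrite /z mxE rmorphM /= Nij conjc_inv mulrA mulrA mulVf ?mul1r //.
    by rewrite conjc_eq0.
  by rewrite -/z -[in LHS](conjc_fixed_real zR).
split=> //; have uN : N \in unitmx by rewrite /N !unitmx_mul unitmx_inv uG uM.
by move: uN; rewrite {1}NR unitmxZ ?unitfE // map_unitmx.
Qed.

Lemma reflectionE u a : reflection u a = u / conjc u * conjc a.
Proof. by []. Qed.

Lemma reflectionK u : u != 0 -> involutive (reflection u).
Proof.
move=> u0 a; rewrite !reflectionE !rmorphM fmorphV /= !conjcK.
have u0' : conjc u != 0 by rewrite conjc_eq0.
by field; rewrite u0.
Qed.

Lemma in_line_reflection u a : u != 0 -> in_line u a <-> reflection u a = a.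
Proof.
move=> u0; have u0' : conjc u != 0 by rewrite conjc_eq0.
rewrite reflectionE; split=> [[t ->]|e].
  have -> : conjc (t%:C * u) = t%:C * conjc u.
    by rewrite -[X in _ = X * _]conjc_real; exact: rmorphM.
  by field.
(* [e] says that [a / u] is its own conjugate, hence the real coefficient of [a] along [u]. *)
exists (Re (a / u)); rewrite conjc_fixed_real ?mulfVK //.
by rewrite rmorphM /= fmorphV /= -{2}e; field; apply/andP.
Qed.

(** Antilinearity produces [conjc a]; moving the factor [conjc c / c] to the other side completes it
    to the reflection of [a] about the line of [c]. *)
Lemma semicommutes_eigen Gam M c a m : Gam \in unitmx ->
  sigma_semicommutes Gam M c -> M *m m = a *: m ->
  M *m sigma Gam m = reflection c a *: sigma Gam m.
Proof.
move=> uG [c0 cM] Mm; have [_ sZ _] := sigma_involution uG.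
have c0' : conjc c != 0 by rewrite conjc_eq0.
have := cM m; rewrite Mm sZ => /(congr1 (fun v => (c / conjc c) *: v)).
by rewrite !scalerA => ->; rewrite mulrA mulfVK // divff // scale1r.
Qed.

Section Directions.
Variables (M : 'M[K]_k) (lam : 'I_k -> K) (m : 'I_k -> 'cV[K]_k).
Hypotheses (Mm : ordered_eigendirections M lam m) (Mgen : generic_eigenvalues M).

Let lam_inj : injective lam.
Proof. by case: Mgen => simple _ _; apply: simple_eigenvalues_inj Mm simple. Qed.

Let lam_eig j : eigenvalue M (lam j).
Proof. by apply/(eigenvalueP_eigendirections _ Mm); exists j. Qed.

Lemma semicommutes_compatible Gam c : Gam \in unitmx ->
  sigma_semicommutes Gam M c -> compatible_line M c.
Proof.
move=> uG cM; have [c0 _] := cM; split=> // _ /(eigenvalueP_eigendirections _ Mm)[j ->].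
have [e|ne] := eqVneq (reflection c (lam j)) (lam j).
  by left; apply/in_line_reflection.
right; exists (reflection c (lam j)); split=> //.
have [_ Me] := Mm; apply: eigenvalue_vector (semicommutes_eigen uG cM (Me j)).
by rewrite (semilinear_eq0 (sigma_involution uG)) (eigendirection_neq0 j Mm).
Qed.

Lemma sigma_direction Gam c i j : Gam \in unitmx ->
  sigma_semicommutes Gam M c -> reflection c (lam i) = lam j ->
  exists2 a, a != 0 & sigma Gam (m i) = a *: m j.
Proof.
move=> uG cM rE; have [_ Me] := Mm.
have := semicommutes_eigen uG cM (Me i); rewrite rE.
case/(eigenvector_line Mm lam_inj) => a aE; exists a => //.
apply: contra_neq (eigendirection_neq0 i Mm) => a0; apply/eqP.
by rewrite -(semilinear_eq0 (sigma_involution uG)) aE a0 scale0r.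
Qed.

(** Hyperbolicity is witnessed by some line, perhaps not that of [c]; genericity carries the
    labelling over. *)
Lemma hyperbolic_reflection c j : hyperbolic M -> compatible_line M c ->
  reflection c (lam j) = lam j.
Proof.
case=> u [uM uline] cM; have [c0 _] := cM; apply/in_line_reflection => //.
case: Mgen => _ _ /(_ u c uM cM _ _ (lam_eig j) (lam_eig j)) [h _].
exact/h/uline.
Qed.

(** Each pair comes with its own line; genericity transfers the pairing to the line of [c]. *)
Lemma paired_reflection c j :
  (forall j, rev_ord j != j -> elliptic_pair M (lam j) (lam (rev_ord j))) ->
  compatible_line M c -> reflection c (lam j) = lam (rev_ord j).
Proof.
move=> pair cM; have [c0 cl] := cM.
have off i : rev_ord i != i -> reflection c (lam i) = lam (rev_ord i).
  move=> /pair[u [uM _ _ _ e]].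
  by case: Mgen => _ _ /(_ u c uM cM _ _ (lam_eig i) (lam_eig (rev_ord i))) [_ []] ->.
(* The middle index, for odd [k]: were [lam j] off the line, it would be exchanged with some
   [lam s], [s != j]; but [lam s] is already exchanged with [lam (rev_ord s)], and
   [rev_ord s != j]. *)
have [jj|/off //] := eqVneq (rev_ord j) j; rewrite jj.
have [/in_line_reflection -> //|[b [eb bj rb]]] := cl _ (lam_eig j).
have /(eigenvalueP_eigendirections _ Mm)[s bE] := eb.
have sj : s != j by apply: contra_neq bj => <-.
have ss : rev_ord s != s.
  apply: contra_neq sj => ss; apply/val_inj => /=.
  have := congr1 val ss; have := congr1 val jj => /=.
  have := ltn_ord s; have := ltn_ord j; lia.
have := off s ss; rewrite -bE -rb reflectionK // => /lam_inj js.
by case/negP: sj; rewrite -(rev_ordK s) -js jj.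
Qed.

End Directions.
End RealStructure.

(** * From four flags in generic position to transverse triples *)

Section GenericPosition.
Variables (F : fieldType) (k : nat) (A B C D : flag F k).
Hypothesis ABCD_gen : generic_position [tuple A; B; C; D].

(** The flag left out gets index 0. The tuple lists [B] second while [transverse] puts it last,
    hence the order [i], [l], [j], [0]. *)
Lemma generic_position_transverse2 : transverse A C B.
Proof.
move=> i j l ijl.
have := ABCD_gen (i := fun t => nth 0%N [:: i; l; j; 0%N] t).
case=> [|_]; first by rewrite !big_ord_recl big_ord0 /=; lia.
rewrite !big_ord_recl big_ord0 /tnth /=.
by rewrite flag0 !addv0 (addvC (B l)) addvA.
Qed.

Lemma generic_position_transverse4 : transverse A C D.
Proof.
move=> i j l ijl.
have := ABCD_gen (i := fun t => nth 0%N [:: i; 0%N; j; l] t).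
case=> [|_]; first by rewrite !big_ord_recl big_ord0 /=; lia.
rewrite !big_ord_recl big_ord0 /tnth /=.
by rewrite flag0 addv0 add0v addvA.
Qed.

End GenericPosition.

(** * Action of the involution on eigendirection flags *)

Section EigenflagImages.
Variables (R : realType) (k : nat) (Gam M : 'M[R[i]]_k) (c : R[i]).
Hypotheses (uGam : Gam \in unitmx) (M_gen : generic_eigenvalues M).
Hypothesis cM : sigma_semicommutes Gam M c.

Lemma hyperbolic_flag_image (A C : flag R[i] k) :
  hyperbolic M -> eigenflag_pair M A C ->
  flag_image (sigma Gam) A A /\ flag_image (sigma Gam) C C.
Proof.
move=> hyp [lam [m [Mm fl]]].
have line j : sig_image (sigma Gam) <[m j]> <[m j]>.
  have rE := hyperbolic_reflection Mm M_gen j hyp (semicommutes_compatible Mm uGam cM).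
  have [a a0 aE] := sigma_direction Mm M_gen uGam cM rE.
  exact (sig_image_line (sigma_involution uGam) a0 aE).
split=> j jk; have [eA eC] := fl j jk; rewrite ?eA ?eC.
  by apply (sig_image_sum (sigma_involution uGam)) => s _; apply: line.
by apply (sig_image_sum (sigma_involution uGam)) => s _; apply: line.
Qed.

Lemma paired_flag_image (beta beta' : flag R[i] k) :
  paired_eigenflag_pair M beta beta' -> flag_image (sigma Gam) beta' beta.
Proof.
move=> [lam [m [Mm pair fl]]] j jk; have [-> ->] := fl j jk.
apply (sig_image_sum (sigma_involution uGam)) => s _.
have rE := paired_reflection Mm M_gen s pair (semicommutes_compatible Mm uGam cM).
have [a a0 aE] := sigma_direction Mm M_gen uGam cM rE.
exact (sig_image_line (sigma_involution uGam) a0 aE).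
Qed.

End EigenflagImages.

(** The line of [m j] is the intersection of a space of [beta] and one of [beta']. Swapping the
    flags sends it to the line of [m (rev_ord j)], whose eigenvalue is the reflection of [lam j]; so
    the relation holds on the basis [m] and extends by semilinearity. *)
Lemma swapped_flags_semicommute (R : realType) (k : nat) (Gam M : 'M[R[i]]_k)
    (u : R[i]) (beta beta' : flag R[i] k) :
  Gam \in unitmx -> generic_eigenvalues M -> compatible_line M u ->
  paired_eigenflag_pair M beta beta' -> flag_image (sigma Gam) beta' beta ->
  sigma_semicommutes Gam M u.
Proof.
move=> uGam Mgen uM [lam [m [Mm pair fl]]] im; have [u0 _] := uM.
have sP := sigma_involution uGam; have [sD sZ sK] := sP.
have im' : flag_image (sigma Gam) beta beta'.
  by move=> j jk; apply: sig_image_sym (im j jk).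
have dir j : exists a, sigma Gam (m j) = a *: m (rev_ord j).
  (* Indices start at 0: [m j] is the last direction to enter [beta j.+1] and also the last to enter
     [beta' (k - j)]. *)
  have lejk : (j.+1 <= k)%N by [].
  have lekj : (k - j <= k)%N by rewrite leq_subr.
  have [bj bj'] := fl _ lejk; have [bk bk'] := fl _ lekj.
  have in_bj : m j \in beta j.+1 by rewrite bj memvE (sumv_sup j).
  have in_bk : m j \in beta' (k - j)%N.
    rewrite bk' memvE (sumv_sup (rev_ord j)) ?rev_ordK //=.
    by have := ltn_ord j; lia.
  (* Reindexed, both target spaces are spanned by parts of the one family [m]; the only common index
     is [rev_ord j]. *)
  have {}bj' : beta' j.+1 = (\sum_(s < k | (rev_ord s < j.+1)%N) <[m s]>)%VS.
    by rewrite bj' (reindex_inj rev_ord_inj); apply: eq_bigr => s _; rewrite rev_ordK.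
  have := mem_image sP (im _ lekj) in_bk; have := mem_image sP (im' _ lejk) in_bj.
  rewrite bk bj'; apply: (mem_sum_directionsI Mm) => s /andP[sk ks]; apply/val_inj => /=.
  by move: sk ks; have := ltn_ord s; have := ltn_ord j; rewrite /=; lia.
split=> // v; have [c ->] := eigendirections_expand v Mm.
have [_ Me] := Mm; rewrite !(mulmx_sumr, semilinear_sum sP) scaler_sumr.
apply: eq_bigr => j _; have [a aE] := dir j.
rewrite -scalemxAr Me !sZ aE -!scalemxAr Me !scalerA.
rewrite -(paired_reflection Mm Mgen j pair uM) reflectionE; congr (_ *: _).
have u0' : conjc u != 0 by rewrite conjc_eq0.
by rewrite /=; field; apply/andP.
Qed.

Theorem theorem8 (R : realType) (k : nat) (k_ge3 : (3 <= k)%N)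
    (G H M : 'M[R[i]]_k)
    (G_unit : G \in unitmx) (H_unit : H \in unitmx) (M_unit : M \in unitmx)
    (G_gen : generic_eigenvalues G) (H_gen : generic_eigenvalues H)
    (M_gen : generic_eigenvalues M)
    (G_hyp : hyperbolic G) (H_hyp : hyperbolic H)
    (GH_real : conjugate_into_PGLR [:: G; H])
    (A B C D : flag R[i] k)
    (AC_G : eigenflag_pair G A C) (BD_H : eigenflag_pair H B D)
    (ABCD_gen : generic_position [tuple A; B; C; D])
    (M_type : elliptic M \/ mixed M) (M_one : at_most_one_hyperbolic M)
    (beta beta' : flag R[i] k)
    (beta_M : paired_eigenflag_pair M beta beta')
    (beta_gen : generic_position [tuple A; beta; C; D])
    (beta'_gen : generic_position [tuple A; beta'; C; D]) :
  conjugate_into_PGLR [:: G; H; M] <->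
  ((forall i j : nat, (i + j + 2)%N = k ->
      cross_ratio_proj A beta C D i j
      = (cross_ratio_proj A beta' C D i j)^*) /\
   (forall i j l : nat, (i + j + l + 3)%N = k ->
      triple_ratio_proj A beta C i j l
      = (triple_ratio_proj A beta' C i j l)^*)).
Proof.
have trB := generic_position_transverse2 beta_gen.
have trB' := generic_position_transverse2 beta'_gen.
have trD := generic_position_transverse4 beta_gen.
split=> [[Gam [uGam real]]|[cr tri]].
  have [cG sG] : exists c, sigma_semicommutes Gam G c.
    by apply: in_PGLR_semicommutes => //; apply: real; rewrite !inE eqxx.
  have [cH sH] : exists c, sigma_semicommutes Gam H c.
    by apply: in_PGLR_semicommutes => //; apply: real; rewrite !inE eqxx orbT.
  have [cM sM] : exists c, sigma_semicommutes Gam M c.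
    by apply: in_PGLR_semicommutes => //; apply: real; rewrite !inE eqxx !orbT.
  have sP := sigma_involution uGam.
  have [imA imC] := hyperbolic_flag_image uGam G_gen sG G_hyp AC_G.
  have [_ imD] := hyperbolic_flag_image uGam H_gen sH H_hyp BD_H.
  have imB := paired_flag_image uGam M_gen sM beta_M.
  (* [sigma Gam] fixes [A], [C], [D] and sends [beta'] to [beta], so the ratios of [beta] are the
     conjugates of those of [beta']. *)
  split=> [i j ij|i j l ijl].
    exact: (cross_ratio_proj_image (@conjcK R) sP imA imB imC trB' imD trD).
  exact: (triple_ratio_proj_image (@conjcK R) sP imA imB imC trB').
have [Gam [uGam real]] := GH_real; have sP := sigma_involution uGam.
have [cG sG] : exists c, sigma_semicommutes Gam G c.
  by apply: in_PGLR_semicommutes => //; apply: real; rewrite !inE eqxx.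
have [cH sH] : exists c, sigma_semicommutes Gam H c.
  by apply: in_PGLR_semicommutes => //; apply: real; rewrite !inE eqxx orbT.
have [imA imC] := hyperbolic_flag_image uGam G_gen sG G_hyp AC_G.
have [_ imD] := hyperbolic_flag_image uGam H_gen sH H_hyp BD_H.
(* [gam] is the image of [beta']: its ratios are conjugate to those of [beta'], hence by [cr] and
   [tri] equal to those of [beta]. *)
have [gam imB] := exists_flag_image sP beta'.
have trG := transverse_image sP imA imB imC trB'.
have betaE : forall j, (j <= k)%N -> beta j = gam j.
  apply: (ratios_determine_flag trB trG trD) => [i j ij|i j l ijl].
    rewrite (cross_ratio_proj_image (@conjcK R) sP imA imB imC trB' imD trD ij).
    exact: cr.
  rewrite (triple_ratio_proj_image (@conjcK R) sP imA imB imC trB' ijl).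
  exact: tri.
(* The direction [u] of a compatible line is the scalar with which [M] will semicommute. *)
have [u [uM _]] := M_one.
have sM : sigma_semicommutes Gam M u.
  apply: (swapped_flags_semicommute uGam M_gen uM beta_M) => j jk.
  by rewrite betaE //; apply: imB.
exists Gam; split=> // N; rewrite !inE => /or3P[/eqP->|/eqP->|/eqP->].
- by apply: real; rewrite !inE eqxx.
- by apply: real; rewrite !inE eqxx orbT.
- exact: semicommutes_in_PGLR sM.
Qed.
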